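(* Let $d\ge2$, let $\Gamma$ be a countable Zariski dense subgroup of $SL(d,\mathbb{R})$, and let $\mu$ be a probability measure on $\Gamma$ with finite entropy and a finite first moment, whose support generates $\Gamma$ as a semigroup. Let $\gamma\in\Gamma$ be an $\mathbb{R}$-regular element. Then the measures $$ \mu^k=\frac12\mu+\frac14\left(\delta_{\gamma^k}+\delta_{\gamma^{-k}}\right),\qquad k\ge 1, $$ have the property that the entropies $H(\mu^k)$ are uniformly bounded in $k$, whereas the lengths $\|\lambda(\mu^k)\|$ of their Lyapunov vectors (equivalently, the top Lyapunov exponents $\lambda_1(\mu^k)$) go to infinity as $k\to\infty$.
   Context: An element of $SL(d,\mathbb{R})$ is $\mathbb{R}$-regular if it is diagonalizable over $\mathbb{R}$ and the absolute values of its eigenvalues are pairwise distinct. $\delta_g$ is the Dirac measure at $g$. The entropy of a probability measure $\mu$ on $\Gamma$ is $H(\mu)=-\sum_g\mu(g)\log\mu(g)$. The measure $\mu$ has a finite first moment if $\sum_g\log\|g\|\,\mu(g)<\infty$, where $\|\cdot\|$ is the standard Euclidean norm. For a probability measure $\mu$ on $\Gamma$ with a finite first moment, the Lyapunov vector (Lyapunov spectrum) $\lambda(\mu)=(\lambda_1(\mu)\ge\dots\ge\lambda_d(\mu))$ is the deterministic vector such that $\frac1n\log a(h_1h_2\cdots h_n)\to\lambda(\mu)$ almost surely, where $(h_n)$ are independent $\mu$-distributed and $a(g)$ is the diagonal matrix of the singular values of $g$ in non-increasing order (so $\sum_i\lambda_i(\mu)=0$). *)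

(* Defs.v *)
(* MathComp + MathComp-Analysis *)
From mathcomp Require Import all_boot all_order all_algebra.
From mathcomp Require Import all_classical all_reals all_analysis.
(* not imported: its notations clash with those of mathcomp-analysis *)
From mathcomp Require mpoly.

Set Implicit Arguments.
Unset Strict Implicit.
Unset Printing Implicit Defensive.

Import Order.TTheory GRing.Theory Num.Theory.
Import numFieldNormedType.Exports.
Local Open Scope classical_set_scope.
Local Open Scope ring_scope.

(* The norm `|A| of the library is the sup norm.  On square matrices enorm
   differs from the operator norm by a factor between 1 and Num.sqrt d%:R, so
   both give the same finite first moment condition. *)
Definition enorm (R : realType) (m n : nat) (A : 'M[R]_(m, n)) : R :=
  Num.sqrt (\sum_i \sum_j A i j ^+ 2).

Definition SL (R : realType) (d : nat) : set 'M[R]_d := [set g | \det g = 1].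

Definition mul_closed (R : realType) (d : nat) (S : set 'M[R]_d) : Prop :=
  forall g h, S g -> S h -> S (g *m h).

Definition subgroup_SL (R : realType) (d : nat) (Gamma : set 'M[R]_d) : Prop :=
  [/\ Gamma `<=` @SL R d, Gamma 1%:M, mul_closed Gamma &
      forall g, Gamma g -> Gamma (invmx g)].

Definition zariski_dense_SL (R : realType) (d : nat) (Gamma : set 'M[R]_d) :
    Prop :=
  forall p : mpoly.mpoly (d * d) R,
    (forall g, Gamma g -> mpoly.meval (fun i => mxvec g 0 i) p = 0) ->
    forall g, @SL R d g -> mpoly.meval (fun i => mxvec g 0 i) p = 0.

(* l lists the eigenvalues with multiplicity, so an R-regular element has d
   distinct eigenvalues. *)
Definition R_regular (R : realType) (d : nat) (g : 'M[R]_d) : Prop :=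
  diagonalizable g /\
  exists l : 'I_d -> R,
    char_poly g = \prod_i ('X - (l i)%:P) /\ injective (fun i => `|l i|).

(* A probability measure on the countable set Gamma is given by its mass
   function, extended by 0 to all matrices. *)
Definition prob_on (R : realType) (d : nat) (Gamma : set 'M[R]_d)
    (mu : 'M[R]_d -> R) : Prop :=
  [/\ forall g, 0 <= mu g, forall g, ~ Gamma g -> mu g = 0 &
      (\esum_(g in Gamma) (mu g)%:E = 1)%E].

Definition supp (R : realType) (d : nat) (mu : 'M[R]_d -> R) : set 'M[R]_d :=
  [set g | mu g != 0].

Definition dirac_mass (R : realType) (d : nat) (a : 'M[R]_d) : 'M[R]_d -> R :=
  fun g => (g == a)%:R.

(* ln 0 = 0, so that the elements of mass 0 do not contribute. *)
Definition entropy (R : realType) (d : nat) (mu : 'M[R]_d -> R) : \bar R :=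
  \esum_(g in [set: 'M[R]_d]) (- (mu g * ln (mu g)))%:E.

Definition finite_first_moment (R : realType) (d : nat) (mu : 'M[R]_d -> R) :
    Prop :=
  (\esum_(g in [set: 'M[R]_d]) (ln (enorm g) * mu g)%:E < +oo)%E.

(* The random elements take values in the countable set Gamma, endowed with the
   sigma-algebra of all its subsets. *)
Definition iid_on (R : realType) (d : nat) (Gamma : set 'M[R]_d)
    (mu : 'M[R]_d -> R) (disp : measure_display) (T : measurableType disp)
    (P : probability T R) (h : nat -> T -> 'M[R]_d) : Prop :=
  [/\ forall n w, Gamma (h n w),
      forall n (A : set 'M[R]_d), measurable (h n @^-1` A),
      forall n g, P (h n @^-1` [set g]) = (mu g)%:E &
      forall (J : seq nat) (A : nat -> set 'M[R]_d), uniq J ->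
        P (\bigcap_(i in [set` J]) (h i @^-1` A i)) =
        (\prod_(i <- J) P (h i @^-1` A i))%E].

(* square roots of the eigenvalues, with multiplicity, of g^T g *)
Definition singular_values (R : realType) (d : nat) (g : 'M[R]_d)
    (s : 'rV[R]_d) : Prop :=
  [/\ forall i, 0 <= s 0 i,
      forall i j : 'I_d, (i <= j)%N -> s 0 j <= s 0 i &
      char_poly (g^T *m g) = \prod_i ('X - (s 0 i ^+ 2)%:P)].

(* lam is the Lyapunov vector of mu.  Whether the convergence holds depends only
   on the joint law of (h n), hence not on the choice of the sequence. *)
Definition lyapunov_vector (R : realType) (d : nat) (Gamma : set 'M[R]_d)
    (mu : 'M[R]_d -> R) (lam : 'rV[R]_d) : Prop :=
  exists (disp : measure_display) (T : measurableType disp)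
         (P : probability T R) (h : nat -> T -> 'M[R]_d),
    iid_on Gamma mu P h /\
    {ae P, forall w, exists a : nat -> 'rV[R]_d,
      (forall n, singular_values (\prod_(m < n) h m w) (a n)) /\
      (forall i, (fun n => n%:R^-1 * ln (a n 0 i)) @ \oo --> lam 0 i)}.

Definition mu_k (R : realType) (d : nat) (mu : 'M[R]_d -> R) (gamma : 'M[R]_d)
    (k : nat) : 'M[R]_d -> R :=
  fun g => 2^-1 * mu g +
    4^-1 * (dirac_mass (gamma ^+ k) g + dirac_mass (invmx gamma ^+ k) g).

(* Main.v *)
(** Let V_n = v h_1 ... h_n be the random walk of a row vector v <> 0, let x be
    the coordinates of v in the eigenbasis of gamma, with eigenvalues delta_i,
    and N v the l1 norm of x.  If x_i and x_j both have size at least e (N v),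
    then
      ln N(v gamma^k) + ln N(v gamma^-k) - 2 ln N(v)
        >= k |ln |delta_i| - ln |delta_j|| + 2 ln e,
    and the left-hand side is always bounded below uniformly in k (take i = j).
    So the expected growth of ln N in one step of mu^k is at least a constant,
    and of order k unless v is close to an eigenline.  By Zariski density some
    element of Gamma moves each eigenline to a vector with two nonzero
    coordinates, hence from every v the walk reaches the set of good directions
    in boundedly many steps, with a probability bounded below independently of
    k and v.  This gives a bounded function phi for which ln N + phi has drift
    at least kap k - C at every v <> 0.  Fatou's lemma, made applicable by
    truncating the integrable increments, turns the drift into the lower bound
    kap k - C for the top exponent.  The entropies are bounded because
    t |-> - t ln t is subadditive. *)
Require Import Defs.
From mathcomp Require Import all_boot all_order all_algebra.
From mathcomp Require Import all_classical all_reals all_analysis.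
From mathcomp Require Import measurable_realfun perm ring lra.
(* only the instances: the notations clash with those of mathcomp-analysis *)
From mathcomp Require Import(canonicals) mpoly.

Set Implicit Arguments.
Unset Strict Implicit.
Unset Printing Implicit Defensive.

Import Order.TTheory GRing.Theory Num.Theory.
Import numFieldNormedType.Exports.
Local Open Scope classical_set_scope.
Local Open Scope ring_scope.

(** * The entrywise l1 norm *)

Definition l1norm (R : realType) (m n : nat) (A : 'M[R]_(m, n)) : R :=
  \sum_i \sum_j `|A i j|.

Lemma l1norm_ge0 (R : realType) (m n : nat) (A : 'M[R]_(m, n)) : 0 <= l1norm A.
Proof. by apply: sumr_ge0 => i _; apply: sumr_ge0. Qed.

Lemma normr_le_l1norm (R : realType) (m n : nat) (A : 'M[R]_(m, n)) i j :
  `|A i j| <= l1norm A.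
Proof.
rewrite /l1norm (bigD1 i)//= (bigD1 j)//= -addrA lerDl addr_ge0 ?sumr_ge0//.
by move=> k _; apply: sumr_ge0.
Qed.

Lemma l1norm_gt0 (R : realType) (m n : nat) (A : 'M[R]_(m, n)) :
  A != 0 -> 0 < l1norm A.
Proof.
move=> A0; rewrite lt_neqAle l1norm_ge0 andbT; apply: contra_neq A0 => l0.
apply/matrixP => i j; rewrite mxE; apply/eqP.
by rewrite -normr_le0 l0 normr_le_l1norm.
Qed.

Lemma l1norm_mul (R : realType) (m n p : nat) (A : 'M[R]_(m, n))
    (B : 'M[R]_(n, p)) : l1norm (A *m B) <= l1norm A * l1norm B.
Proof.
rewrite /l1norm mulr_suml; apply: ler_sum => i _.
apply: (@le_trans _ _ (\sum_j \sum_k `|A i k| * `|B k j|)).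
  apply: ler_sum => j _; rewrite mxE (le_trans (ler_norm_sum _ _ _))//.
  by apply: ler_sum => k _; rewrite normrM.
rewrite exchange_big mulr_suml/=; apply: ler_sum => k _.
rewrite -mulr_sumr ler_wpM2l//.
by rewrite [leRHS](bigD1 k)//= lerDl sumr_ge0// => l _; apply: sumr_ge0.
Qed.

Lemma normr_le_enorm (R : realType) (m n : nat) (A : 'M[R]_(m, n)) i j :
  `|A i j| <= enorm A.
Proof.
rewrite -sqrtr_sqr ler_wsqrtr// (bigD1 i)//= (bigD1 j)//= -addrA lerDl.
rewrite addr_ge0 ?sumr_ge0// => [? _|? _]; first exact: sqr_ge0.
by apply: sumr_ge0 => ? _; exact: sqr_ge0.
Qed.

Lemma l1norm_le (R : realType) (m n : nat) (A : 'M[R]_(m, n)) (B : R) :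
  (forall i j, `|A i j| <= B) -> l1norm A <= (m * n)%:R * B.
Proof.
move=> AB; rewrite natrM -mulrA.
have -> : m%:R * (n%:R * B) = \sum_(i < m) \sum_(j < n) B.
  by rewrite !sumr_const !card_ord !mulr_natl.
by apply: ler_sum => i _; apply: ler_sum.
Qed.

(** For determinant 1 the inverse is the adjugate. Each of its entries is a signed sum of at most
    [d!] products of [d - 1] entries of [g], and [1 <= B] allows the exponent to be raised to
    [d]. *)
Lemma invmx_entry_le (R : realType) (d : nat) (g : 'M[R]_d) (B : R) i j :
  \det g = 1 -> 1 <= B -> (forall i j, `|g i j| <= B) ->
  `|invmx g i j| <= (d`!)%:R * B ^+ d.
Proof.
move=> g1 B1 gB.
have B0 : 0 <= B by rewrite (le_trans _ B1).
rewrite /invmx unitmxE g1 unitr1 invr1 scale1r mxE expand_cofactor.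
rewrite (le_trans (ler_norm_sum _ _ _))//.
rewrite (@le_trans _ _ (\sum_(s : 'S_d | s j == i) B ^+ d))//.
  apply: ler_sum => s _; rewrite normrM normrX normrN1 expr1n mul1r normr_prod.
  rewrite (@le_trans _ _ (\prod_(k | j != k) B))//.
    by apply: ler_prod => k _; rewrite normr_ge0 gB.
  rewrite prodr_const ler_weXn2l//.
  by rewrite (leq_trans (max_card _))// card_ord.
rewrite sumr_const mulr_natl ler_wpMn2l ?exprn_ge0//.
by rewrite (leq_trans (max_card _))// (eq_leq (card_Sn _)).
Qed.

(** In the coordinates [v *m Q] the matrix [g] acts as [invmx Q *m g *m Q], and the l1 norm is
    submultiplicative. The second bound is the first one for [invmx g], applied to [v *m g]. *)
Lemma growth_bound (R : realType) (d : nat) (Q : 'M[R]_d) : Q \in unitmx ->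
  exists2 K : R, 1 <= K & forall (v : 'rV[R]_d) (g : 'M[R]_d), \det g = 1 ->
    l1norm (v *m g *m Q) <= K * Num.max 1 (enorm g) ^+ d * l1norm (v *m Q) /\
    l1norm (v *m Q) <= K * Num.max 1 (enorm g) ^+ d * l1norm (v *m g *m Q).
Proof.
move=> Qu; set C := l1norm (invmx Q) * l1norm Q.
have C0 : 0 <= C by rewrite mulr_ge0 ?l1norm_ge0.
exists (Num.max 1 (C * ((d * d)%:R * (d`!)%:R))); first by rewrite le_max lexx.
(* The entry bound [d! B ^ d] is loose enough to cover both [g] and its inverse. *)
have key (v : 'rV[R]_d) (g : 'M[R]_d) (B : R) : 1 <= B ->
    (forall i j, `|g i j| <= d`!%:R * B ^+ d) ->
    l1norm (v *m g *m Q) <=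
    Num.max 1 (C * ((d * d)%:R * (d`!)%:R)) * B ^+ d * l1norm (v *m Q).
  move=> B1 gB; have -> : v *m g *m Q = v *m Q *m (invmx Q *m g *m Q).
    by rewrite !mulmxA mulmxK.
  apply: le_trans (l1norm_mul _ _) _; rewrite mulrC ler_wpM2r ?l1norm_ge0//.
  apply: le_trans (l1norm_mul _ _) _.
  apply: (@le_trans _ _ (C * ((d * d)%:R * (d`!)%:R) * B ^+ d)).
    have -> : C * ((d * d)%:R * d`!%:R) * B ^+ d =
        l1norm (invmx Q) * ((d * d)%:R * (d`!%:R * B ^+ d)) * l1norm Q.
      by rewrite /C; ring.
    rewrite ler_wpM2r ?l1norm_ge0// (le_trans (l1norm_mul _ _))//.
    by rewrite ler_wpM2l ?l1norm_ge0//; apply: l1norm_le.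
  by rewrite ler_wpM2r ?exprn_ge0 ?le_max ?lexx ?orbT// (le_trans ler01).
move=> v g g1; set B := Num.max 1 (enorm g).
have B1 : 1 <= B by rewrite le_max lexx.
have gB i j : `|g i j| <= B by rewrite le_max normr_le_enorm orbT.
split; first (apply: key => // i j).
  rewrite (le_trans (gB i j))//; have dpos : (0 < d)%N by case: (d) i => // -[].
  rewrite -[leLHS]mul1r ler_pM// ?ler1n ?fact_gt0// ?(le_trans ler01)//.
  by rewrite -[leLHS]expr1 ler_weXn2l.
have gu : g \in unitmx by rewrite unitmxE g1 unitr1.
have := @key (v *m g) (invmx g) B B1; rewrite mulmxK//; apply=> i j.
exact: invmx_entry_le.
Qed.

(** * Countably valued random variables *)

(** The values carry no sigma-algebra: [e] codes [S] by integers, and the preimage of any [A] is a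
    countable union of fibres over single points and empty sets. *)
Lemma countable_range_preimage (disp : measure_display) (T : measurableType disp)
    (C : Type) (S : set C) (X : T -> C) :
  countable S -> (forall w, S (X w)) ->
  (forall c, measurable (X @^-1` [set c])) ->
  forall A : set C, measurable (X @^-1` A).
Proof.
move=> /countable_injP[e einj] XS mX A.
have -> : X @^-1` A = \bigcup_k (X @^-1` [set c | [/\ A c, S c & e c = k]]).
  apply/seteqP; split=> [w Aw|w [k _ []]//]; exists (e (X w)) => //=; split=> //.
apply: bigcupT_measurable => k.
have [[c [Ac Sc ek]]|nc] := pselect (exists c, [/\ A c, S c & e c = k]).
  have -> : [set c | [/\ A c, S c & e c = k]] = [set c]; last exact: mX.
  apply/seteqP; split=> [x [Ax Sx ex]|x ->//].
  by apply: einj; [exact: mem_set|exact: mem_set|rewrite ex ek].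
rewrite [X in _ @^-1` X](_ : _ = set0) ?preimage_set0//.
by apply/seteqP; split=> // x xk; case: nc; exists x.
Qed.

Lemma integral_countable_range (R : realType) (disp : measure_display)
    (T : measurableType disp) (P : probability T R) (C : choiceType)
    (S : set C) (X : T -> C) (f : C -> \bar R) :
  countable S -> (forall w, S (X w)) ->
  (forall c, measurable (X @^-1` [set c])) ->
  (forall c, 0 <= f c)%E ->
  (\int[P]_w f (X w) = \esum_(c in S) (f c * P (X @^-1` [set c])))%E.
Proof.
move=> cS XS mX f0; have mXA := countable_range_preimage cS XS mX.
case/countable_injP : cS => e einj.
pose F k := X @^-1` [set c | S c /\ e c = k].
have TF : [set: T] = \bigcup_k F k.
  by apply/seteqP; split=> // w _; exists (e (X w)) => //=.
have FE c : S c -> F (e c) = X @^-1` [set c].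
  move=> Sc; apply/seteqP; split=> w /=; last by rewrite /F /= => ->.
  case=> SX.
  by apply: einj => //; exact: mem_set.
rewrite TF ge0_integral_bigcup//; first last.
- apply/trivIsetP => i j _ _ ij; apply/seteqP; split=> // w [[_ /= ei] [_ /= ej]].
  by move: ij; rewrite -ei ej eqxx.
- move=> _ Y mY; rewrite -TF setTI (_ : _ @^-1` _ = X @^-1` (f @^-1` Y))//.
- by move=> k; exact: mXA.
rewrite nneseries_esumT; last by move=> k; apply: integral_ge0 => *; exact: f0.
(* Integers outside the image of [S] index empty fibres and contribute nothing. *)
rewrite -(@setUv _ (e @` S)) (esumID (e @` S)) ?setUv//; last first.
  by move=> i _; apply: integral_ge0 => *; exact: f0.
rewrite !setTI [X in (_ + X)%E]esum1 ?adde0.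
  rewrite esum_image; last exact: einj.
  apply: eq_esum => c Sc; rewrite FE//.
  rewrite (eq_integral (cst (f c))); last by move=> w /set_mem ->.
  by rewrite integral_cst.
move=> k ek; rewrite (_ : F k = set0) ?integral_set0//.
by apply/seteqP; split=> // w [SX eX]; case: ek; exists (X w).
Qed.

Lemma ge0_esumZl (R : realType) (C : choiceType) (S : set C) (f : C -> \bar R)
    (r : R) : 0 <= r -> (forall c, 0 <= f c)%E ->
  (\esum_(c in S) (r%:E * f c) = r%:E * \esum_(c in S) f c)%E.
Proof.
move=> r0 f0; rewrite /esum -ereal_supZl//; last first.
  apply/set0P; exists (\sum_(x \in set0) f x)%E; exists set0 => //.
  by split.
congr ereal_sup; apply/seteqP; split=> [_ [A AS <-]|_ [_ [A AS <-] <-]].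
  by exists (\sum_(x \in A) f x)%E; [exists A|rewrite ge0_mule_fsumr].
by exists A => //; rewrite ge0_mule_fsumr.
Qed.

(** * Histories of an i.i.d. sequence *)

Definition history (T C : Type) (h : nat -> T -> C) (n : nat) (w : T) : seq C :=
  [seq h i w | i <- iota 0 n].

(** The values of [history h n] lie in this set, countable when [S] is, so every function of the
    past is measurable. *)
Definition words (C : eqType) (S : set C) (n : nat) : set (seq C) :=
  [set s | size s = n /\ forall c, c \in s -> S c].

Lemma countable_words (C : eqType) (S : set C) (n : nat) :
  countable S -> countable (words S n).
Proof.
case/countable_injP => e einj; apply/countable_injP.
exists (fun s => choice.pickle (map e s)) => s t /set_mem[_ sS] /set_mem[_ tS].
move=> /(pcan_inj choice.pickleK).
elim: s t sS tS => [|x s IH] [|y t]//= sS tS [exy est]; congr (_ :: _).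
  by apply: einj => //; apply: mem_set; [apply: sS|apply: tS]; rewrite mem_head.
by apply: IH => // c cs; [apply: sS|apply: tS]; rewrite in_cons cs orbT.
Qed.

Lemma history_words (T : Type) (C : eqType) (S : set C) (h : nat -> T -> C) n w :
  (forall i w, S (h i w)) -> words S n (history h n w).
Proof.
move=> hS; split; first by rewrite size_map size_iota.
by move=> c /mapP[i _ ->].
Qed.

Lemma history_preimage (T C : Type) (c0 : C) (h : nat -> T -> C)
    (s : seq C) :
  history h (size s) @^-1` [set s] =
  \bigcap_(i in [set` iota 0 (size s)]) (h i @^-1` [set nth c0 s i]).
Proof.
apply/seteqP; split=> w /=; rewrite /history.
  move=> hs i /=; rewrite mem_iota add0n => /= is_.
  by rewrite -[in RHS]hs (nth_map 0%N) ?size_iota// nth_iota.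
move=> hs; apply: (@eq_from_nth _ c0); first by rewrite size_map size_iota.
move=> i; rewrite size_map size_iota => is_.
by rewrite (nth_map 0%N) ?size_iota// nth_iota// hs//= mem_iota.
Qed.

Lemma iid_history_independent (R : realType) (d : nat) (Gamma : set 'M[R]_d)
    (mu : 'M[R]_d -> R) (disp : measure_display) (T : measurableType disp)
    (P : probability T R) (h : nat -> T -> 'M[R]_d) (s : seq 'M[R]_d) g :
  iid_on Gamma mu P h ->
  (P (history h (size s) @^-1` [set s] `&` h (size s) @^-1` [set g]) =
   P (history h (size s) @^-1` [set s]) * (mu g)%:E)%E.
Proof.
move=> [_ _ Pmu indep].
have -> : history h (size s) @^-1` [set s] `&` h (size s) @^-1` [set g] =
    history h (size (rcons s g)) @^-1` [set rcons s g].
  apply/seteqP; split=> w /=; rewrite /history size_rcons -addn1 iotaD add0n.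
    by move=> [hs hg]; rewrite map_cat hs /= hg cats1.
  rewrite map_cat /= cats1 => /eqP; rewrite eqseq_rcons => /andP[/eqP -> /eqP ->].
  by [].
rewrite !(history_preimage 0) !indep ?iota_uniq// size_rcons -addn1 iotaD.
rewrite big_cat /= big_seq1 add0n Pmu nth_rcons ltnn eqxx; congr (_ * _)%E.
apply: eq_big_seq => i; rewrite mem_iota add0n => /= is_.
by rewrite nth_rcons is_.
Qed.

Lemma measurable_history (R : realType) (d : nat) (Gamma : set 'M[R]_d)
    (mu : 'M[R]_d -> R) (disp : measure_display) (T : measurableType disp)
    (P : probability T R) (h : nat -> T -> 'M[R]_d) (n : nat) :
  countable Gamma -> iid_on Gamma mu P h ->
  forall A, measurable (history h n @^-1` A).
Proof.
move=> cG [hG hm _ _]; apply: (countable_range_preimage (countable_words n cG)).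
  by move=> w; exact: history_words.
move=> s; have [<-|sn] := eqVneq (size s) n.
  rewrite (history_preimage 0); apply: fin_bigcap_measurable => [|i _]; last exact: hm.
  exact: finite_seq.
rewrite (_ : _ @^-1` _ = set0)//; apply/seteqP; split=> // w /= ws.
by case/eqP: sn; rewrite -ws size_map size_iota.
Qed.

(** This replaces conditioning on the past: by independence the integral is a double sum over the
    history [s] and the next step [g], and the bound on the inner sum is uniform in [s]. *)
Lemma iid_integral_history (R : realType) (d : nat) (Gamma : set 'M[R]_d)
    (mu : 'M[R]_d -> R) (disp : measure_display) (T : measurableType disp)
    (P : probability T R) (h : nat -> T -> 'M[R]_d) (n : nat)
    (f : seq 'M[R]_d -> 'M[R]_d -> \bar R) (b : \bar R) :
  countable Gamma -> iid_on Gamma mu P h ->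
  (forall s g, 0 <= f s g)%E ->
  (forall s, words Gamma n s ->
     (b <= \esum_(g in Gamma) ((mu g)%:E * f s g))%E) ->
  (b <= \int[P]_w f (history h n w) (h n w))%E.
Proof.
move=> cG hiid f0 fb.
have [b0|/ltW b0] := leP 0%E b; last first.
  by apply: (le_trans b0); exact: integral_ge0.
have mH := measurable_history n cG hiid.
have [hG hm Pmu _] := hiid.
have cW := countable_words n cG; have hW w := history_words n w hG.
have mu0 g : (0 <= (mu g)%:E)%E by rewrite -(Pmu 0%N g).
have -> : b = (\int[P]_w cst b (history h n w))%E.
  rewrite (_ : (fun w : T => cst b (history h n w)) = cst b)//.
  by rewrite integral_cst// -[LHS]mule1; congr (_ * _)%E; apply/esym; exact: probability_setT.
rewrite (integral_countable_range P (S := words Gamma n))//.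
rewrite (integral_countable_range P (S := words Gamma n `*`` (fun=> Gamma))
  (X := fun w => (history h n w, h n w)) (f := fun p => f p.1 p.2))//=.
- pose a s g := (P (history h n @^-1` [set s]) * ((mu g)%:E * f s g))%E.
  rewrite [leRHS](eq_esum (b := fun k => a k.1 k.2)); last first.
    move=> [s g] [/= [sn _] Gg]; rewrite /a muleA muleC; congr (_ * _)%E.
    rewrite -sn -(iid_history_independent s g hiid); congr (P _).
    by apply/seteqP; split=> w /= => [[-> ->]|[-> ->]].
  rewrite -(esum_esum (a := a)); last by move=> *; rewrite !mule_ge0.
  apply: le_esum => s sW; rewrite /a.
  rewrite -(fineK (fin_num_measure P _ (mH [set s]))) ge0_esumZl ?fine_ge0//.
    by rewrite muleC lee_wpmul2l ?fb// lee_fin fine_ge0.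
  by move=> g; exact: mule_ge0.
- exact: countableXR (fun _ _ => cG).
- move=> [s g]; rewrite (_ : _ @^-1` _ =
      history h n @^-1` [set s] `&` h n @^-1` [set g]); first exact: measurableI.
  by apply/seteqP; split=> w /= => [[-> ->]|[-> ->]].
Qed.

Lemma historyS (T C : Type) (h : nat -> T -> C) (n : nat) (w : T) :
  history h n.+1 w = rcons (history h n w) (h n w).
Proof. by rewrite /history -addn1 iotaD map_cat cats1. Qed.

Lemma limn_einf_ge (R : realType) (u : nat -> \bar R) (c : \bar R) (N : nat) :
  (forall n, (N <= n)%N -> (c <= u n)%E) -> (c <= limn_einf u)%E.
Proof.
move=> cu; rewrite limn_einf_lim; apply: lime_ge; first exact: is_cvg_einfs.
exists N => // n Nn; apply: le_ereal_inf_tmp => _ [k nk <-].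
by apply: cu; exact: leq_trans nk.
Qed.

Lemma limn_einf_le (R : realType) (u : nat -> \bar R) (c : \bar R) (N : nat) :
  (forall n, (N <= n)%N -> (u n <= c)%E) -> (limn_einf u <= c)%E.
Proof.
move=> uc; rewrite limn_einf_lim; apply: lime_le; first exact: is_cvg_einfs.
exists N => // n Nn; apply: le_trans (uc _ Nn).
by apply: ereal_inf_lbound; exists n => /=.
Qed.

Lemma measurable_fun_history (R : realType) (d : nat) (Gamma : set 'M[R]_d)
    (mu : 'M[R]_d -> R) (disp : measure_display) (T : measurableType disp)
    (P : probability T R) (h : nat -> T -> 'M[R]_d) (n : nat)
    (f : seq 'M[R]_d -> \bar R) :
  countable Gamma -> iid_on Gamma mu P h ->
  measurable_fun [set: T] (fun w => f (history h n w)).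
Proof.
move=> cG hiid _ Y mY; rewrite setTI.
exact: (measurable_history n cG hiid (f @^-1` Y)).
Qed.

Lemma iid_integral (R : realType) (d : nat) (Gamma : set 'M[R]_d)
    (mu : 'M[R]_d -> R) (disp : measure_display) (T : measurableType disp)
    (P : probability T R) (h : nat -> T -> 'M[R]_d) (n : nat) (f : 'M[R]_d -> R) :
  countable Gamma -> iid_on Gamma mu P h -> (forall g, 0 <= f g) ->
  (\int[P]_w (f (h n w))%:E = \esum_(g in Gamma) (mu g * f g)%:E)%E.
Proof.
move=> cG [hG hm Pmu _] f0.
rewrite (integral_countable_range P (S := Gamma) (X := h n) (f := fun g => (f g)%:E))//.
by apply: eq_esum => g _; rewrite Pmu -EFinM mulrC.
Qed.

Lemma iid_integral_sum (R : realType) (d : nat) (Gamma : set 'M[R]_d)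
    (mu : 'M[R]_d -> R) (disp : measure_display) (T : measurableType disp)
    (P : probability T R) (h : nat -> T -> 'M[R]_d) (n : nat) (f : 'M[R]_d -> R) :
  countable Gamma -> iid_on Gamma mu P h -> (forall g, 0 <= f g) ->
  (\int[P]_w (\sum_(i < n) f (h i w))%:E =
   n%:R%:E * \esum_(g in Gamma) (mu g * f g)%:E)%E.
Proof.
move=> cG hiid f0.
under eq_integral do rewrite -sumEFin.
rewrite ge0_integral_sum//; last 2 first.
- move=> i _ Y mY; rewrite setTI; have [_ hm _ _] := hiid.
  exact: (hm i ((fun g => (f g)%:E) @^-1` Y)).
- by move=> i w _; rewrite lee_fin.
under eq_bigr do rewrite (iid_integral _ cG hiid f0).
by rewrite big_const_ord mule_natl; elim: n => [|n IH]; rewrite ?mule0n ?muleS -?IH.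
Qed.

(** Some finite partial sum comes within [e] of the total. Its index set tells where the increments
    are truncated in [drift_le_exponent]. *)
Lemma summable_tail (R : realType) (C : choiceType) (S : set C) (f : C -> R)
    (e : R) : 0 < e -> (forall c, 0 <= f c) ->
  (\esum_(c in S) (f c)%:E < +oo)%E ->
  exists s : seq C, (\esum_(c in S) (if c \in s then 0 else f c)%:E <= e%:E)%E.
Proof.
move=> e0 f0 fS.
have ffin : \esum_(c in S) (f c)%:E \is a fin_num.
  by rewrite ge0_fin_numE// esum_ge0// => c _; rewrite lee_fin.
have [_ [F [finF FS] <-] tail] := ub_ereal_sup_adherent e0 ffin.
have [s Fs] := (finite_seqP F).1 finF; exists s.
have split_f : (\esum_(c in S) (f c)%:E =
    \sum_(c \in F) (f c)%:E + \esum_(c in S) (if c \in s then 0 else f c)%:E)%E.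
  have -> : (\sum_(c \in F) (f c)%:E = \esum_(c in S) (if c \in s then f c else 0)%:E)%E.
    rewrite -esum_fset// => [|c _]; last by rewrite lee_fin.
    rewrite -[in LHS](setIidr FS) esum_mkcondr; apply: eq_esum => c _.
    by rewrite Fs mem_setE; case: ifP.
  rewrite -esumD; last 2 first.
  - by move=> c _; rewrite lee_fin; case: ifP.
  - by move=> c _; rewrite lee_fin; case: ifP.
  by apply: eq_esum => c _; case: ifP; rewrite ?adde0 ?add0e.
have {}tail : (\esum_(c in S) (f c)%:E - e%:E < \sum_(c \in F) (f c)%:E)%E := tail.
move: tail ffin; rewrite split_f.
move: (\sum_(c \in F) _)%E (esum _ _) => x y tail.
rewrite fin_numD => /andP[xf yf]; move: tail.
by rewrite -(fineK xf) -(fineK yf) -!EFinD lte_fin lee_fin => ?; lra.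
Qed.

(** * Drift and exponential growth *)

Lemma history_sum (V : zmodType) (T C : Type) (h : nat -> T -> C) (n : nat) (w : T)
    (f : C -> V) :
  \sum_(i < n) f (h i w) = \sum_(g <- history h n w) f g.
Proof. by rewrite /history big_map -(big_mkord xpredT (fun i => f (h i w))) /index_iota subn0. Qed.

(** The drift hypothesis says that [Z + phi] grows by at least [a] on average; [D + l g] is added on
    both sides so that the summands are nonnegative. If [lam < a], Fatou's lemma for [Q n / n]
    fails: the means are at most about [B + e - a], while almost surely the lower limit is at least
    [B - lam - e]. *)
Lemma drift_le_exponent (R : realType) (d : nat) (Gamma : set 'M[R]_d)
    (mu : 'M[R]_d -> R) (disp : measure_display) (T : measurableType disp)
    (P : probability T R) (h : nat -> T -> 'M[R]_d)
    (l : 'M[R]_d -> R) (Z phi : seq 'M[R]_d -> R) (D a lam : R) :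
  countable Gamma -> iid_on Gamma mu P h ->
  (forall g, 0 <= l g) -> (\esum_(g in Gamma) (mu g * l g)%:E < +oo)%E ->
  (forall s, 0 <= phi s <= D) ->
  (forall n s g, words Gamma n s -> Gamma g -> `|Z (rcons s g) - Z s| <= l g) ->
  (forall n s, words Gamma n s ->
     ((a + D)%:E + \esum_(g in Gamma) (mu g * l g)%:E <=
      \esum_(g in Gamma) (mu g *
        (Z (rcons s g) - Z s + (phi (rcons s g) - phi s) + D + l g))%:E)%E) ->
  {ae P, forall w, exists2 u : nat -> R, u @ \oo --> lam &
     forall n, Z (history h n w) - Z [::] <= n%:R * u n} ->
  a <= lam.
Proof.
move=> cG hiid l0 lfin phiD Zl drift aeZ.
have [hG hm Pmu _] := hiid.
have mu0 g : 0 <= mu g by rewrite -lee_fin -(Pmu 0%N g).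
have D0 : 0 <= D by have /andP[] := phiD [::]; exact: le_trans.
rewrite leNgt; apply/negP => lam_a.
(* The final contradiction is [B + 2 e - a < B - lam - e], which needs [3 e < a - lam]. *)
pose e := (a - lam) / 4; have e0 : 0 < e by rewrite /e; lra.
have [s0 tail] := summable_tail e0 (fun g => mulr_ge0 (mu0 g) (l0 g)) lfin.
(* The sum bounds [l] on [s0]; the other two terms make [B - lam - e] nonnegative, as the last
   comparison of integrals requires. *)
pose B := \sum_(g <- s0) l g + `|lam| + e.
pose tau g := if g \in s0 then 0 else l g.
have tau0 g : 0 <= tau g by rewrite /tau; case: ifP.
have ltau g : l g <= B + tau g.
  rewrite /tau /B; case: ifP => [gs|_].
    rewrite (big_rem g)//= addr0 -!addrA lerDl !addr_ge0 ?sumr_ge0//; exact: ltW.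
  by rewrite lerDr !addr_ge0 ?sumr_ge0//; exact: ltW.
pose L := fine (\esum_(g in Gamma) (mu g * l g)%:E)%E.
have LE : \esum_(g in Gamma) (mu g * l g)%:E = L%:E.
  by rewrite fineK// ge0_fin_numE// esum_ge0// => g _; rewrite lee_fin mulr_ge0.
have B0 : 0 <= B by rewrite !addr_ge0 ?sumr_ge0//; exact: ltW.
have {}tail : (\esum_(g in Gamma) (mu g * tau g)%:E <= e%:E)%E.
  apply: le_trans tail; apply: le_esum => g _; rewrite lee_fin /tau.
  by case: ifP; rewrite ?mulr0.
have Pwords n w : words Gamma n (history h n w) by exact: history_words.
pose Psi s g := Z (rcons s g) - Z s + (phi (rcons s g) - phi s) + D + l g.
(* [iid_integral_history] asks for nonnegativity at all [s] and [g]; along the walk the maximum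
   changes nothing. *)
pose Phi s g := Num.max 0 (Psi s g).
have PhiE i w : Phi (history h i w) (h i w) = Psi (history h i w) (h i w).
  apply/max_r; rewrite /Psi.
  have := Zl _ _ _ (Pwords i w) (hG i w); rewrite ler_norml => /andP[Z1 _].
  have /andP[p1 _] := phiD (rcons (history h i w) (h i w)).
  have /andP[_ p2] := phiD (history h i w).
  by lra.
have Phi_int i : ((a + D + L)%:E <= \int[P]_w (Phi (history h i w) (h i w))%:E)%E.
  apply: (iid_integral_history (f := fun s g => (Phi s g)%:E) cG hiid) => [s g|s sW].
    by rewrite lee_fin le_max lexx.
  rewrite EFinD -LE (le_trans (drift _ _ sW))//; apply: le_esum => g _.
  by rewrite -EFinM lee_fin ler_wpM2l// le_max lexx orbT.
pose S n w := \sum_(i < n) l (h i w).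
pose Tau n w := \sum_(i < n) tau (h i w).
(* Q is nonnegative, as needed by Fatou: tau is what remains of the bound l on
   the increments of Z after truncation at B, and has expectation at most e. *)
pose Q n w := n%:R * B + Tau n w - (Z (history h n w) - Z [::]).
have ZS n w : Z (history h n w) - Z [::] <= n%:R * B + Tau n w.
  elim: n => [|n IH]; first by rewrite subrr mul0r add0r /Tau big_ord0.
  rewrite historyS /Tau big_ord_recr/= -/(Tau n w) mulrSr mulrDl mul1r.
  have := Zl _ _ _ (Pwords n w) (hG n w); rewrite ler_norml => /andP[_ Z1].
  by have := ltau (h n w); lra.
have Q0 n w : 0 <= Q n w by rewrite /Q; have := ZS n w; lra.
(* The increments of [Z] in [Psi] cancel against [Q], so only nonnegative functions have to be
   integrated. *)
have telescope n w : Q n w + \sum_(i < n) Phi (history h i w) (h i w) =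
    n%:R * (B + D) + (phi (history h n w) - phi [::]) + (Tau n w + S n w).
  rewrite /Q /S; elim: n => [|n IH]; first by rewrite !mul0r !big_ord0; ring.
  rewrite !historyS /Tau !big_ord_recr/= -/(Tau n w) mulrSr !mulrDl !mul1r.
  by move: IH; rewrite PhiE /Psi mulrDr; lra.
have mHist n f : measurable_fun [set: T] (fun w => (f (history h n w) : R)%:E).
  exact: (measurable_fun_history n (fun s => (f s)%:E) cG hiid).
have mQ n : measurable_fun [set: T] (fun w => (Q n w)%:E).
  rewrite (_ : (fun w => _) = (fun w => (n%:R * B + \sum_(g <- history h n w) tau g
     - (Z (history h n w) - Z [::]))%:E)).
    exact: (mHist n (fun s => n%:R * B + \sum_(g <- s) tau g - (Z s - Z [::]))).
  by apply/funext => w; rewrite -(history_sum h n w tau).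
have mS n : measurable_fun [set: T] (fun w => (S n w)%:E).
  rewrite (_ : (fun w => _) = (fun w => (\sum_(g <- history h n w) l g)%:E)).
    exact: (mHist n (fun s => \sum_(g <- s) l g)).
  by apply/funext => w; rewrite -(history_sum h n w l).
have mTau n : measurable_fun [set: T] (fun w => (Tau n w)%:E).
  rewrite (_ : (fun w => _) = (fun w => (\sum_(g <- history h n w) tau g)%:E)).
    exact: (mHist n (fun s => \sum_(g <- s) tau g)).
  by apply/funext => w; rewrite -(history_sum h n w tau).
have mPhi n : measurable_fun [set: T] (fun w => (Phi (history h n w) (h n w))%:E).
  rewrite (_ : (fun w => _) = (fun w => (Phi (take n (history h n.+1 w))
     (nth 0 (history h n.+1 w) n))%:E)).
    exact: (mHist n.+1 (fun s => Phi (take n s) (nth 0 s n))).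
  apply/funext => w; rewrite historyS; have [sn _] := Pwords n w.
  by rewrite -cats1 nth_cat take_cat sn ltnn subnn take0 cats0.
have integral_cst1 r : (\int[P]_w r%:E = r%:E)%E.
  rewrite integral_cst// -[RHS]mule1; congr (_ * _)%E; exact: probability_setT.
(* Integrate [telescope]: the sum of the [Phi] has mean at least [n (a + D + L)], the sums [Tau] and
   [S] have means at most [n e] and [n L], and the [phi] terms cost at most [D]. *)
have Q_int n : (\int[P]_w (Q n w)%:E <= (n%:R * (B + e - a) + D)%:E)%E.
  have Q0' w : [set: T] w -> (0 <= (Q n w)%:E)%E by rewrite lee_fin.
  have Phi0 i w : (0 <= (Phi (history h i w) (h i w))%:E)%E.
    by rewrite lee_fin le_max lexx.
  have sumPhi0 w : (0 <= \sum_(i < n) (Phi (history h i w) (h i w))%:E)%E.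
    exact: sume_ge0.
  have msumPhi : measurable_fun [set: T]
      (fun w => \sum_(i < n) (Phi (history h i w) (h i w))%:E)%E.
    exact: emeasurable_sum.
  have sum_le : (\int[P]_w ((Q n w)%:E + \sum_(i < n) (Phi (history h i w) (h i w))%:E) <=
      \int[P]_w ((n%:R * (B + D) + D)%:E + ((Tau n w)%:E + (S n w)%:E)))%E.
    apply: ge0_le_integral => //.
    - by move=> w _; apply: adde_ge0; [exact: Q0'|exact: sumPhi0].
    - exact: emeasurable_funD.
    - by apply: emeasurable_funD => //; exact: emeasurable_funD.
    - move=> w _; rewrite sumEFin -!EFinD lee_fin telescope lerD2r lerD2l.
      have /andP[_ ?] := phiD (history h n w); have /andP[? _] := phiD [::].
      by lra.
  have lower : ((n%:R * (a + D + L))%:E <=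
      \int[P]_w (\sum_(i < n) (Phi (history h i w) (h i w))%:E))%E.
    rewrite ge0_integral_sum//; apply: (@le_trans _ _ (\sum_(i < n) (a + D + L)%:E)%E).
      by rewrite sumEFin sumr_const card_ord mulr_natl.
    by apply: lee_sum => i _; exact: Phi_int.
  have upper : (\int[P]_w ((n%:R * (B + D) + D)%:E + ((Tau n w)%:E + (S n w)%:E)) <=
      (n%:R * (B + D) + D + (n%:R * e + n%:R * L))%:E)%E.
    have Tau0 w : [set: T] w -> (0 <= (Tau n w)%:E)%E by rewrite lee_fin sumr_ge0.
    have S0 w : [set: T] w -> (0 <= (S n w)%:E)%E by rewrite lee_fin sumr_ge0.
    rewrite ge0_integralD//; last 3 first.
    - by move=> w _; rewrite lee_fin addr_ge0// mulr_ge0// addr_ge0.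
    - by move=> w Tw; apply: adde_ge0; [exact: Tau0|exact: S0].
    - exact: emeasurable_funD.
    rewrite ge0_integralD// integral_cst1 !(iid_integral_sum _ cG hiid)//.
    rewrite LE [leRHS]EFinD leeD2l// [leRHS]EFinD.
    by rewrite leeD// EFinM lee_wpmul2l// lee_fin.
  have := le_trans sum_le upper; rewrite ge0_integralD//.
  move/(le_trans (leeD2l _ lower)); rewrite -leeBrDr// -EFinB => /le_trans; apply.
  by rewrite lee_fin; lra.
pose F n w := (n.+1%:R^-1 * Q n.+1 w)%:E.
have F0 n w : [set: T] w -> (0 <= F n w)%E.
  by move=> _; rewrite lee_fin mulr_ge0 ?invr_ge0.
have mF n : measurable_fun [set: T] (F n).
  have -> : F n = (fun w => (n.+1%:R^-1)%:E * (Q n.+1 w)%:E)%E.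
    by apply/funext => w; rewrite -EFinM.
  exact: measurable_funeM.
have pos_lim w : (0 <= limn_einf (F^~ w))%E.
  by apply: (@limn_einf_ge _ _ _ 0) => n _; exact: F0.
have mlim : measurable_fun [set: T] (fun w => limn_einf (F^~ w)).
  (* The lower limit is minus the upper limit of the opposite sequence, whose measurability is
     known. *)
  have mN (f : T -> \bar R) : measurable_fun [set: T] f ->
      measurable_fun [set: T] (fun w => - f w)%E.
    move=> mf; rewrite (_ : (fun w => _) = (fun w => (-1)%:E * f w)%E).
      exact: measurable_funeM.
    by apply/funext => w; rewrite EFinN mulN1e.
  apply: (mN _); apply: (@measurable_fun_limn_esup _ _ _ _ (fun n w => - F n w)%E) => n.
  exact: mN.
have := fatou P measurableT mF F0; apply/negP; rewrite -ltNge.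
apply: (@le_lt_trans _ _ (B + e + e - a)%:E).
  (* Beyond [N] the boundary term [D], divided by the time, is below [e]. *)
  pose N := Num.bound (D / e); apply: (@limn_einf_le _ _ _ N) => n Nn.
  have -> : (\int[P]_w F n w = (n.+1%:R^-1)%:E * \int[P]_w (Q n.+1 w)%:E)%E.
    rewrite -ge0_integralZl//.
    by move=> w _; rewrite lee_fin.
  apply: (@le_trans _ _ ((n.+1%:R^-1)%:E * (n.+1%:R * (B + e - a) + D)%:E)%E).
    by rewrite lee_wpmul2l// lee_fin invr_ge0.
  have n0 : 0 < n.+1%:R :> R by [].
  rewrite -EFinM lee_fin mulrC ler_pdivrMr//.
  have : D / e < n.+1%:R.
    apply: lt_le_trans (archi_boundP _) _; first by rewrite divr_ge0// ltW.
    by rewrite ler_nat leqW.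
  by rewrite ltr_pdivrMr// mulrC; set m := n.+1%:R => ?; lra.
apply: (@lt_le_trans _ _ (B - lam - e)%:E); first by rewrite lte_fin /e; lra.
rewrite -integral_cst1; apply: ae_ge0_le_integral => //.
- move=> w _; rewrite lee_fin /B; have := ler_norm lam.
  have : 0 <= \sum_(g <- s0) l g by rewrite sumr_ge0.
  by lra.
apply: filterS aeZ => w [u ulam Zu] _.
(* Once [u n <= lam + e], dropping [Tau >= 0] gives [Q n / n >= B - lam - e]. *)
have [N _ uN] := cvgr_le _ ulam (lam + e) (etrans (ltrDl _ _) e0).
apply: (@limn_einf_ge _ _ _ N) => n Nn; rewrite lee_fin.
have n0 : 0 < n.+1%:R :> R by [].
rewrite mulrC ler_pdivlMr// /Q.
have := Zu n.+1; have := uN _ (leqW Nn); rewrite -(ler_pM2l n0).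
have : 0 <= Tau n.+1 w by rewrite sumr_ge0.
by set m := n.+1%:R; lra.
Qed.

(** * Escaping the eigenlines *)

Lemma det_transvection (R : comNzRingType) (d : nat) (i j : 'I_d) : i != j ->
  \det (1%:M + delta_mx i j : 'M[R]_d) = 1.
Proof.
wlog ij : i j / (j < i)%N => [H neq_ij|neq_ij].
  have [ji|] := ltnP j i; first exact: H.
  rewrite leq_eqVlt (inj_eq val_inj) (negPf neq_ij)/= => ij.
  by rewrite -det_tr linearD/= trmx1 trmx_delta; apply: H; rewrite // eq_sym.
rewrite det_trig ?big1// => [k _|].
  rewrite !mxE eqxx; have [->|] := eqVneq k i; rewrite ?addr0//=.
  by rewrite (negPf neq_ij) addr0.
apply/is_trig_mxP => u v uv; rewrite !mxE.
have -> : (u == v) = false by apply/eqP => e; rewrite e ltnn in uv.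
case: eqP => [e1|_]; case: eqP => [e2|_]; rewrite ?addr0//.
by move: uv; rewrite e1 e2 ltnNge ltnW.
Qed.

(** The product of the two entries is a polynomial in [g]. If it vanished on [Gamma] it would vanish
    on all of SL, but it is 1 at the conjugate by [A] of the transvection [1 + delta_mx i j]. *)
Lemma zariski_dense_entries (R : realType) (d : nat) (Gamma : set 'M[R]_d)
    (A : 'M[R]_d) (i j : 'I_d) :
  zariski_dense_SL Gamma -> A \in unitmx -> i != j ->
  exists2 g, Gamma g & (A *m g *m invmx A) i i != 0 /\
                       (A *m g *m invmx A) i j != 0.
Proof.
move=> dense Au ij.
pose entry k : mpoly.mpoly (d * d) R := \sum_u \sum_v
  (A i u * invmx A v k) *: mpoly.mpolyX R (mpoly.mnm1 (mxvec_index u v)).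
have entryE g k : mpoly.meval (fun i => mxvec g 0 i) (entry k) =
    (A *m g *m invmx A) i k.
  rewrite raddf_sum/= mxE.
  under eq_bigr do rewrite raddf_sum/=.
  rewrite exchange_big; apply: eq_bigr => v _; rewrite mxE mulr_suml.
  by apply: eq_bigr => u _; rewrite mpoly.mevalZ mpoly.mevalXU mxvecE mulrAC.
apply: contrapT => no_g.
have := dense (entry i * entry j).
have vanish g : Gamma g ->
    mpoly.meval (fun i => mxvec g 0 i) (entry i * entry j) = 0.
  move=> Gg; rewrite mpoly.mevalM !entryE; apply/eqP; rewrite mulf_eq0.
  apply: contra_notT no_g; rewrite negb_or => /andP[gi gj].
  by exists g.
move=> /(_ vanish (invmx A *m (1%:M + delta_mx i j) *m A)).
rewrite /SL /= !det_mulmx det_transvection// mulr1 -det_mulmx mulVmx// det1.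
move=> /(_ erefl); rewrite mpoly.mevalM !entryE !mulmxA mulmxV// mul1mx mulmxK//.
rewrite !mxE !eqxx (negPf ij) /= ?addr0 ?add0r ?mulr1.
by move/eqP; rewrite oner_eq0.
Qed.

(** The witness is the inverse of [1] plus the sum of the inverses; the [1] also covers an empty
    [I]. *)
Lemma finite_pos_lower_bound (R : realFieldType) (I : finType) (f : I -> R) :
  (forall i, 0 < f i) -> exists2 e, 0 < e & forall i, e <= f i.
Proof.
move=> f0; have fV0 i : 0 <= (f i)^-1 by rewrite invr_ge0 ltW.
have s0 : 0 < 1 + \sum_i (f i)^-1 by rewrite ltr_pwDl// sumr_ge0.
exists (1 + \sum_i (f i)^-1)^-1; first by rewrite invr_gt0.
move=> i; rewrite -[leRHS]invrK lef_pV2 ?posrE ?invr_gt0//.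
by rewrite (bigD1 i)//= addrCA lerDl addr_ge0// sumr_ge0.
Qed.

(** Each of the [n] steps must have mass at least [q], so a walk with law [mu] enters [A] at time
    [n] with probability at least [q ^ n]. Bounding the steps one by one makes concatenation
    immediate. *)
Fixpoint reach (R : realType) (d : nat) (mu : 'M[R]_d -> R) (q : R)
    (A : set 'rV[R]_d) (n : nat) : set 'rV[R]_d :=
  if n is m.+1 then [set v | exists2 g, q <= mu g & reach mu q A m (v *m g)]
  else A.

Lemma reach_mono (R : realType) (d : nat) (mu : 'M[R]_d -> R) (q q' : R)
    (A B : set 'rV[R]_d) (n : nat) :
  q' <= q -> A `<=` B -> reach mu q A n `<=` reach mu q' B n.
Proof.
move=> qq AB; elim: n => [//|n IH] v [g qg vg]; exists g; last exact: IH.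
exact: le_trans qg.
Qed.

Lemma reachD (R : realType) (d : nat) (mu : 'M[R]_d -> R) (q : R)
    (A : set 'rV[R]_d) (m n : nat) :
  reach mu q (reach mu q A n) m = reach mu q A (m + n).
Proof. by elim: m => [//|m IH] /=; rewrite IH. Qed.

(** The elements with this property contain the support and are closed under products: lengths add
    up, and the smaller of the two values of [q] is kept. *)
Lemma semigroup_reach (R : realType) (d : nat) (Gamma : set 'M[R]_d)
    (mu : 'M[R]_d -> R) (g : 'M[R]_d) :
  (forall g, 0 <= mu g) -> smallest (@mul_closed R d) (supp mu) = Gamma ->
  Gamma g -> exists q n, 0 < q /\
    forall (A : set 'rV[R]_d) v, A (v *m g) -> reach mu q A n v.
Proof.
move=> mu0 <-; apply: (@smallest_sub _ (@mul_closed R d) _ [set g | exists q n, 0 < q /\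
  forall (A : set 'rV[R]_d) v, A (v *m g) -> reach mu q A n v]).
  move=> g1 g2 /= [q1 [n1 [q10 r1]]] [q2 [n2 [q20 r2]]].
  exists (Num.min q1 q2), (n1 + n2)%N; split; first by rewrite lt_min q10.
  move=> A v; rewrite mulmxA -reachD => /r2 r; apply: (reach_mono (q := q1)).
  - by rewrite ge_min lexx.
  - exact: subset_refl.
  by apply: r1; apply: reach_mono r; rewrite ?ge_min ?lexx ?orbT.
move=> {}g /= g0; exists (mu g), 1%N; split; first by rewrite lt_neqAle eq_sym g0 mu0.
by move=> A v Avg; exists g.
Qed.

(** A scale-invariant way to stay away from the eigenlines, when [v *m Q] lists the coordinates of
    [v] in an eigenbasis. *)
Definition two_coords (R : realType) (d : nat) (Q : 'M[R]_d) (e : R) :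
    set 'rV[R]_d :=
  [set v | exists i j, [/\ i != j, e * l1norm (v *m Q) <= `|(v *m Q) 0 i| &
                           e * l1norm (v *m Q) <= `|(v *m Q) 0 j|]].

Lemma l1norm_row (R : realType) (d : nat) (x : 'rV[R]_d) :
  l1norm x = \sum_i `|x 0 i|.
Proof. by rewrite /l1norm big_ord1. Qed.

(** Otherwise the [d] coordinates would add up to at most half of the norm. *)
Lemma big_coord (R : realType) (d : nat) (x : 'rV[R]_d) (e : R) :
  x != 0 -> e * (2 * d%:R) <= 1 -> exists i, e * l1norm x <= `|x 0 i|.
Proof.
move=> /l1norm_gt0 x0 ed; apply: contrapT => /forallNP small.
have : l1norm x <= d%:R * (e * l1norm x).
  rewrite {1}l1norm_row -[d in d%:R]card_ord mulr_natl -sumr_const.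
  by apply: ler_sum => i _; apply/ltW; rewrite ltNge; apply/negP; exact: small.
have -> : d%:R * (e * l1norm x) = (e * (2 * d%:R)) * l1norm x / 2 by field.
have : e * (2 * d%:R) * l1norm x <= l1norm x by rewrite ler_piMl// ltW.
by lra.
Qed.

(** Write N for the norm of [x]. The coordinate [i] carries at least N / 2, so it contributes at
    least [eta] N / 2, hence [2 e] N [l1norm B], to coordinate [c] of [x *m B]. The others
    contribute at most [e] N [l1norm B], and what is left dominates [e * l1norm (x *m B)]. *)
Lemma near_eigenline_escape (R : realType) (d : nat) (x : 'rV[R]_d)
    (B : 'M[R]_d) (i c : 'I_d) (e eta : R) :
  0 < e -> e * (2 * d%:R) <= 1 -> e * (4 * l1norm B) <= eta -> eta <= `|B i c| ->
  (forall k, k != i -> `|x 0 k| <= e * l1norm x) ->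
  e * l1norm (x *m B) <= `|(x *m B) 0 c|.
Proof.
move=> e0 ed eB etaB small.
have N0 := l1norm_ge0 x; have K0 := l1norm_ge0 B.
have xi : l1norm x / 2 <= `|x 0 i|.
  have : l1norm x <= `|x 0 i| + d%:R * (e * l1norm x).
    rewrite {1}l1norm_row (bigD1 i)//= lerD2l.
    apply: (@le_trans _ _ (\sum_(k | k != i) e * l1norm x)).
      exact: ler_sum.
    rewrite sumr_const mulr_natl ler_wpMn2l ?mulr_ge0 ?(ltW e0)//.
    by rewrite (leq_trans (max_card _)) ?card_ord.
  have -> : d%:R * (e * l1norm x) = (e * (2 * d%:R)) * l1norm x / 2 by field.
  have : e * (2 * d%:R) * l1norm x <= l1norm x by rewrite ler_piMl.
  by lra.
have rest : `|\sum_(k | k != i) x 0 k * B k c| <= e * l1norm x * l1norm B.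
  rewrite (le_trans (ler_norm_sum _ _ _))//.
  apply: (@le_trans _ _ (\sum_k e * l1norm x * `|B k c|)).
    rewrite [leRHS](bigID (fun k => k != i))/= -[leLHS]addr0 lerD//.
      by apply: ler_sum => k ki; rewrite normrM ler_wpM2r// small.
    by apply: sumr_ge0 => k _; rewrite !mulr_ge0// ltW.
  rewrite -mulr_sumr ler_wpM2l ?mulr_ge0 ?(ltW e0)//.
  rewrite /l1norm exchange_big/= [leRHS](bigD1 c)//= lerDl sumr_ge0// => k _.
  by rewrite sumr_ge0.
have main : l1norm x / 2 * eta <= `|x 0 i * B i c|.
  by rewrite normrM ler_pM ?divr_ge0// (le_trans _ eB)// !mulr_ge0// ltW.
have yc : `|x 0 i * B i c| <= `|(x *m B) 0 c| + e * l1norm x * l1norm B.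
  rewrite mxE (bigD1 i)//= (le_trans _ (lerD (lexx _) rest))//.
  set r := \sum_(k | _) _; rewrite -{1}[x 0 i * B i c](addrK r).
  by rewrite (le_trans (ler_normB _ _)).
have : e * l1norm (x *m B) <= e * (l1norm x * l1norm B).
  by rewrite ler_pM2l// l1norm_mul.
have := ler_wpM2l N0 eB; lra.
Qed.

(** A vector that is not already good has exactly one large coordinate [i], so it lies near an
    eigenline. An element of [Gamma] with nonzero entries [(i, i)] and [(i, j)] in the eigenbasis
    then gives it two large coordinates. There are only [d] eigenlines, whence uniform constants. *)
Lemma reach_two_coords (R : realType) (d : nat) (Gamma : set 'M[R]_d)
    (mu : 'M[R]_d -> R) (A : 'M[R]_d) :
  (1 < d)%N -> zariski_dense_SL Gamma -> (forall g, 0 <= mu g) ->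
  smallest (@mul_closed R d) (supp mu) = Gamma -> A \in unitmx ->
  exists e q M, [/\ 0 < e, e * (2 * d%:R) <= 1, 0 < q &
    forall v, v != 0 ->
      exists2 n, (n <= M)%N & reach mu q (two_coords (invmx A) e) n v].
Proof.
move=> d1 dense mu0 gen Au.
(* [t] packs a threshold for [e], a mass and a number of steps. All smaller [e] are allowed, because
   the common [e] is chosen only after all [i] are treated. *)
have escape i : exists t : R * R * nat, [/\ 0 < t.1.1, 0 < t.1.2 &
    forall e, 0 < e -> e * (2 * d%:R) <= 1 -> e <= t.1.1 -> forall v : 'rV[R]_d,
    (forall k, k != i -> `|(v *m invmx A) 0 k| <= e * l1norm (v *m invmx A)) ->
    reach mu t.1.2 (two_coords (invmx A) e) t.2 v].
  have [j ij] : exists j : 'I_d, i != j.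
    have [i0|i0] := eqVneq (nat_of_ord i) 0%N.
      by exists (Ordinal d1); rewrite -val_eqE /= i0.
    by exists (Ordinal (ltnW d1)).
  have [g Gg [gi gj]] := zariski_dense_entries dense Au ij.
  have [q [n [q0 qn]]] := semigroup_reach mu0 gen Gg.
  set B := A *m g *m invmx A in gi gj.
  have B0 : 0 < l1norm B.
    by apply: lt_le_trans (normr_le_l1norm B i i); rewrite normr_gt0.
  pose eta := Num.min `|B i i| `|B i j|.
  have eta0 : 0 < eta by rewrite lt_min !normr_gt0 gi gj.
  exists (eta / (4 * l1norm B), q, n); split=> //=; first by rewrite divr_gt0 ?mulr_gt0.
  move=> e e0 ed; rewrite ler_pdivlMr ?mulr_gt0// => eB v small; apply: qn.
  have -> : v *m g = v *m invmx A *m B *m A.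
    by rewrite /B !mulmxA !mulmxKV.
  have [etai etaj] : eta <= `|B i i| /\ eta <= `|B i j|.
    by rewrite /eta !ge_min !lexx orbT.
  exists i, j; rewrite mulmxK//; split=> //.
    exact: (near_eigenline_escape e0 ed eB etai small).
  exact: (near_eigenline_escape e0 ed eB etaj small).
have [t tP] := choice escape.
have [|e1 e10 e1P] := @finite_pos_lower_bound _ _ (fun i => (t i).1.1).
  by move=> i; case: (tP i).
have [|q q0 qP] := @finite_pos_lower_bound _ _ (fun i => (t i).1.2).
  by move=> i; case: (tP i).
have d0 : 0 < 2 * d%:R :> R by rewrite mulr_gt0// ltr0n ltnW.
pose e := Num.min e1 (2 * d%:R)^-1.
have e0 : 0 < e by rewrite lt_min e10 invr_gt0.
have ed : e * (2 * d%:R) <= 1 by rewrite -ler_pdivlMr// div1r ge_min lexx orbT.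
exists e, q, (\max_i (t i).2)%N; split=> // v v0.
have [good|bad] := pselect (two_coords (invmx A) e v); first by exists 0%N.
have x0 : v *m invmx A != 0.
  by apply: contra_neq v0 => vA0; rewrite -(mulmxKV Au v) vA0 mul0mx.
have [i xi] := big_coord x0 ed.
exists (t i).2; first exact: leq_bigmax.
have [_ _ ti] := tP i; apply: (reach_mono (qP i) (@subset_refl _ _)).
apply: ti => // [|k ki]; first by rewrite (le_trans _ (e1P i))// ge_min lexx.
rewrite leNgt; apply/negP => xk; apply: bad.
by exists i, k; split=> //; [rewrite eq_sym|exact: ltW].
Qed.

Lemma diagonal_power (R : fieldType) (d : nat) (gamma Q : 'M[R]_d)
    (delta : 'I_d -> R) (k : nat) (v : 'rV[R]_d) (i : 'I_d) :
  (forall (v : 'rV[R]_d) i, (v *m gamma *m Q) 0 i = (v *m Q) 0 i * delta i) ->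
  (v *m gamma ^+ k *m Q) 0 i = (v *m Q) 0 i * delta i ^+ k.
Proof.
move=> gQ; elim: k => [|k IH]; first by rewrite !expr0 mulr1 mulmx1.
by rewrite exprSr -mulmxE mulmxA gQ IH exprSr mulrA.
Qed.

(** * The regular element *)

Lemma char_poly_conj (R : comUnitRingType) (d : nat) (A g : 'M[R]_d) :
  A \in unitmx -> char_poly (A *m g *m invmx A) = char_poly g.
Proof.
move=> Au; rewrite /char_poly.
have -> : char_poly_mx (A *m g *m invmx A) =
    map_mx polyC A *m char_poly_mx g *m map_mx polyC (invmx A).
  rewrite /char_poly_mx mulmxBr mulmxBl -!map_mxM; congr (_ - _).
  by rewrite scalar_mxC -mulmxA -map_mxM mulmxV// map_mx1 mulmx1.
rewrite !det_mulmx mulrC mulrA -det_mulmx -map_mxM mulVmx// map_mx1 det1 mul1r.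
by [].
Qed.

(** The rows of [A] are eigenvectors, so [v *m invmx A] gives the coordinates of [v]. Comparing
    characteristic polynomials, the diagonal entries [delta] are a permutation of the eigenvalues
    [l], hence have distinct absolute values; they are nonzero since their product is 1. *)
Lemma R_regular_eigenbasis (R : realType) (d : nat) (gamma : 'M[R]_d) :
  \det gamma = 1 -> R_regular gamma ->
  exists (A : 'M[R]_d) (delta : 'I_d -> R) (kappa : R), [/\ A \in unitmx, 0 < kappa,
    forall i, delta i != 0,
    forall (v : 'rV[R]_d) i, (v *m gamma *m invmx A) 0 i = (v *m invmx A) 0 i * delta i &
    forall i j : 'I_d, i != j -> kappa <= `|ln `|delta i| - ln `|delta j| |].
Proof.
move=> g1 [[A Au]]; rewrite /similar_to conjumx// => /is_diag_mxP diag.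
set B := A *m gamma *m invmx A in diag *.
move=> [l [charl linj]]; pose delta i := B i i.
have detB : \det B = 1 by rewrite !det_mulmx g1 mulr1 -det_mulmx mulmxV// det1.
have trigB : is_trig_mx B.
  by apply/is_trig_mxP => i j ij; apply: diag; rewrite ltn_eqF.
have delta0 i : delta i != 0.
  have : \prod_i B i i != 0 by rewrite -(det_trig trigB) detB oner_eq0.
  by move/prodf_neq0 => /(_ i isT).
have perm_l : perm_eq [seq l i | i <- enum 'I_d] [seq delta i | i <- enum 'I_d].
  apply: prod_XsubC_eq; rewrite [LHS]big_map [RHS]big_map !big_enum/=.
  by rewrite -charl -(char_poly_conj gamma Au) char_poly_trig.
have delta_inj : injective (fun i => `|delta i|).
  apply/injectiveP; rewrite /injectiveb /dinjectiveb.
  have := perm_map (fun x : R => `|x|) perm_l.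
  rewrite -!map_comp => /perm_uniq <-; 
  by rewrite (map_inj_uniq linj) -enumT enum_uniq.
(* Pairs with equal indices get the dummy value 1, so that the minimum runs over all pairs. *)
have [|kappa kappa0 kappaP] := @finite_pos_lower_bound R ('I_d * 'I_d)%type
    (fun p => if p.1 == p.2 then 1 else `|ln `|delta p.1| - ln `|delta p.2| |).
  move=> [i j] /=; case: eqP => [//|/eqP ij]; rewrite normr_gt0 subr_eq0.
  apply: contra_neq ij => /ln_inj ij. apply: delta_inj.
  by apply: ij; rewrite posrE normr_gt0.
exists A, delta, kappa; split=> //.
  move=> v i; have -> : v *m gamma *m invmx A = v *m invmx A *m B.
    by rewrite /B !mulmxA mulmxKV.
  rewrite mxE (bigD1 i)//= big1 ?addr0// => k ki.
  by rewrite diag ?mulr0// val_eqE.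
by move=> i j ij; have := kappaP (i, j); rewrite /= (negPf ij).
Qed.

(** The norm of [v gamma ^ k] is bounded below by coordinate [i], and that of [v gamma ^ -k] by
    coordinate [j]. The case [i = j] is allowed and gives the bound uniform in [k]. *)
Lemma diagonal_growth (R : realType) (d : nat) (gamma Q : 'M[R]_d)
    (delta : 'I_d -> R) (k : nat) (v : 'rV[R]_d) (i j : 'I_d) (e : R) :
  gamma \in unitmx -> (forall i, delta i != 0) ->
  (forall (v : 'rV[R]_d) i, (v *m gamma *m Q) 0 i = (v *m Q) 0 i * delta i) ->
  v *m Q != 0 -> 0 < e -> e * l1norm (v *m Q) <= `|(v *m Q) 0 i| ->
  e * l1norm (v *m Q) <= `|(v *m Q) 0 j| ->
  k%:R * (ln `|delta i| - ln `|delta j|) + 2 * ln e + 2 * ln (l1norm (v *m Q)) <=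
  ln (l1norm (v *m gamma ^+ k *m Q)) + ln (l1norm (v *m invmx gamma ^+ k *m Q)).
Proof.
move=> gu delta0 gQ x0 e0 xi xj; have N0 := l1norm_gt0 x0.
have gVQ (u : 'rV[R]_d) m : (u *m invmx gamma *m Q) 0 m = (u *m Q) 0 m * (delta m)^-1.
  by rewrite -{2}(mulmxKV gu u) gQ mulfK.
have half (g : 'M[R]_d) (b : 'I_d -> R) m : (forall i, b i != 0) ->
    (forall (v : 'rV[R]_d) i, (v *m g *m Q) 0 i = (v *m Q) 0 i * b i) ->
    e * l1norm (v *m Q) <= `|(v *m Q) 0 m| ->
    k%:R * ln `|b m| + ln e + ln (l1norm (v *m Q)) <= ln (l1norm (v *m g ^+ k *m Q)).
  move=> b0 bQ xm; have bm : 0 < `|b m| by rewrite normr_gt0.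
  rewrite mulr_natl -lnXn// -addrA -lnM ?posrE// -lnM ?posrE ?exprn_gt0 ?mulr_gt0//.
  have le : `|b m| ^+ k * (e * l1norm (v *m Q)) <= l1norm (v *m g ^+ k *m Q).
    apply: le_trans (normr_le_l1norm _ 0 m).
    by rewrite (diagonal_power _ _ _ bQ) normrM normrX mulrC ler_wpM2r ?exprn_ge0.
  have pos : 0 < `|b m| ^+ k * (e * l1norm (v *m Q)) by rewrite !mulr_gt0 ?exprn_gt0.
  by rewrite ler_ln ?posrE// (lt_le_trans pos).
have := half _ _ _ delta0 gQ xi.
have := half _ _ j (fun i => invr_neq0 (delta0 i)) gVQ xj.
by rewrite normfV lnV ?posrE ?normr_gt0//; lra.
Qed.

(** * The measures mu_k *)

(** The square of [enorm g] is the trace of [g^T *m g], that is the sum of the squared singular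
    values. This ties the growth of the walk to the top exponent. *)
Lemma enorm_le_singular (R : realType) (d : nat) (g : 'M[R]_d) (s : 'rV[R]_d)
    (i0 : 'I_d) : nat_of_ord i0 = 0%N -> singular_values g s ->
  enorm g <= d%:R * s 0 i0.
Proof.
move=> i00 [s0 s_mono char_s].
have dpos : (0 < d)%N by rewrite (leq_ltn_trans _ (ltn_ord i0)).
have s00 := s0 i0.
have sumE : \sum_i \sum_j g i j ^+ 2 = \sum_i s 0 i ^+ 2.
  (* both sides are the trace of g^T g, a coefficient of its char_poly *)
  transitivity (\tr (g^T *m g)).
    rewrite exchange_big; apply: eq_bigr => j _; rewrite mxE.
    by apply: eq_bigr => i _; rewrite mxE expr2.
  apply: oppr_inj; rewrite -char_poly_trace// char_s.
  have prodE : \prod_(p <- [seq s 0 i ^+ 2 | i <- enum 'I_d]) ('X - p%:P) =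
      \prod_i ('X - (s 0 i ^+ 2)%:P) by rewrite big_map big_enum.
  have sum_map : \sum_(p <- [seq s 0 i ^+ 2 | i <- enum 'I_d]) p =
      \sum_i s 0 i ^+ 2 by rewrite big_map big_enum.
  have := @coefPn_prod_XsubC R [seq s 0 i ^+ 2 | i <- enum 'I_d].
  by rewrite size_map size_enum_ord -lt0n prodE sum_map; apply.
rewrite /enorm sumE -[leRHS]ger0_norm ?mulr_ge0// -sqrtr_sqr ler_wsqrtr//.
apply: (@le_trans _ _ (\sum_(i < d) s 0 i0 ^+ 2)).
  apply: ler_sum => i _; rewrite ler_pXn2r ?nnegrE//.
  by apply: s_mono; rewrite i00.
rewrite sumr_const card_ord exprMn -[leLHS]mulr_natl ler_wpM2r ?exprn_ge0//.
by rewrite -natrX ler_nat -{1}(expn1 d) leq_pexp2l.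
Qed.

Lemma ge0_esum_ge (R : realType) (C : choiceType) (S : set C) (f : C -> \bar R) c :
  (forall x, 0 <= f x)%E -> S c -> (f c <= \esum_(x in S) f x)%E.
Proof.
move=> f0 Sc; apply: esum_ge; exists [set c]; last by rewrite fsbig_set1.
by split=> // x ->.
Qed.

Lemma esum_dirac_mass (R : realType) (d : nat) (S : set 'M[R]_d) (a : 'M[R]_d)
    (f : 'M[R]_d -> R) : S a -> (forall g, 0 <= f g) ->
  (\esum_(g in S) (dirac_mass a g * f g)%:E = (f a)%:E)%E.
Proof.
move=> Sa f0; rewrite (esumID [set a]); last first.
  by move=> g _; rewrite lee_fin mulr_ge0// /dirac_mass ler0n.
rewrite [X in (_ + X)%E]esum1 ?adde0; last first.
  by move=> g [_ /eqP ga]; rewrite /dirac_mass (negPf ga) mul0r.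
rewrite (_ : S `&` [set a] = [set a]).
  by rewrite esum_set1 /dirac_mass eqxx mul1r// lee_fin.
by apply/seteqP; split=> [x []|x /= ->].
Qed.

Lemma esum_mu_k (R : realType) (d : nat) (S : set 'M[R]_d) (mu : 'M[R]_d -> R)
    (gamma : 'M[R]_d) (k : nat) (f : 'M[R]_d -> R) :
  (forall g, 0 <= mu g) -> (forall g, 0 <= f g) ->
  S (gamma ^+ k) -> S (invmx gamma ^+ k) ->
  (\esum_(g in S) (mu_k mu gamma k g * f g)%:E =
   2^-1%:E * (\esum_(g in S) (mu g * f g)%:E) +
   (4^-1 * (f (gamma ^+ k) + f (invmx gamma ^+ k)))%:E)%E.
Proof.
move=> mu0 f0 Sg Sg'.
pose a := gamma ^+ k; pose b := invmx gamma ^+ k.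
rewrite (eq_esum (b := fun g => (2^-1%:E * (mu g * f g)%:E +
    (4^-1%:E * (dirac_mass a g * f g)%:E + 4^-1%:E * (dirac_mass b g * f g)%:E))%E)).
  have d0 c g : (0 <= (dirac_mass c g * f g)%:E)%E.
    by rewrite lee_fin mulr_ge0// /dirac_mass ler0n.
  have m0 g : (0 <= (mu g * f g)%:E)%E by rewrite lee_fin mulr_ge0.
  have h2 : (0 <= 2^-1 :> R) by rewrite invr_ge0.
  have h4 : (0 <= 4^-1 :> R) by rewrite invr_ge0.
  rewrite esumD; last 2 first.
  - by move=> g _; rewrite mule_ge0// lee_fin.
  - by move=> g _; rewrite adde_ge0// mule_ge0// lee_fin.
  rewrite ge0_esumZl//. congr (_ + _)%E; rewrite esumD; last 2 first.
  - by move=> g _; rewrite mule_ge0// lee_fin.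
  - by move=> g _; rewrite mule_ge0// lee_fin.
  by rewrite !ge0_esumZl// !esum_dirac_mass// mulrDr EFinD !EFinM.
move=> g _; rewrite -!EFinM -!EFinD; congr (_%:E).
by rewrite /mu_k -/a -/b; ring.
Qed.

(** * Entropy of the measures [mu_k] *)

Lemma neg_xlnx_subadditive (R : realType) (a b : R) : 0 <= a -> 0 <= b ->
  - ((a + b) * ln (a + b)) <= - (a * ln a) - b * ln b.
Proof.
move=> a_ge0 b_ge0.
have [->|a_neq0] := eqVneq a 0; first by rewrite !add0r !mul0r oppr0 add0r.
have [->|b_neq0] := eqVneq b 0; first by rewrite !addr0 !mul0r subr0.
have a0 : 0 < a by rewrite lt_neqAle eq_sym a_neq0.
have b0 : 0 < b by rewrite lt_neqAle eq_sym b_neq0.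
have la : a * ln a <= a * ln (a + b).
  by rewrite ler_pM2l// ler_ln ?posrE ?addr_gt0// lerDl ltW.
have lb : b * ln b <= b * ln (a + b).
  by rewrite ler_pM2l// ler_ln ?posrE ?addr_gt0// lerDr ltW.
by lra.
Qed.

Lemma neg_xlnx_mul (R : realType) (r x : R) : 0 < r -> 0 <= x ->
  - (r * x * ln (r * x)) = r * - (x * ln x) + x * - (r * ln r).
Proof.
move=> r0; rewrite le_eqVlt => /predU1P[<-|x0]; first by rewrite mulr0 !mul0r; ring.
by rewrite lnM ?posrE//; ring.
Qed.

Lemma neg_xlnx_ge0 (R : realType) (x : R) : 0 <= x -> x <= 1 -> 0 <= - (x * ln x).
Proof. by move=> x0 x1; rewrite -mulrN mulr_ge0// oppr_ge0 ln_le0. Qed.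

Lemma prob_le1 (R : realType) (d : nat) (Gamma : set 'M[R]_d) mu g :
  prob_on Gamma mu -> mu g <= 1.
Proof.
move=> [mu0 muG mu1]; have [Gg|/muG ->//] := pselect (Gamma g).
by rewrite -lee_fin -mu1; apply: (@ge0_esum_ge _ _ _ (fun g => (mu g)%:E)).
Qed.

(** Subadditivity handles any overlap of the three parts of [mu_k]. Scaling by 1/2 and 1/4 costs
    [c2] and twice [c4], and Dirac masses have zero entropy. *)
Lemma entropy_mu_k_bounded (R : realType) (d : nat) (Gamma : set 'M[R]_d)
    (mu : 'M[R]_d -> R) (gamma : 'M[R]_d) :
  prob_on Gamma mu -> (entropy mu < +oo)%E ->
  exists C : R, forall k, (entropy (mu_k mu gamma k) <= C%:E)%E.
Proof.
move=> mu_prob Hfin; have [mu0 muG mu1] := mu_prob.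
have eta0 g : 0 <= - (mu g * ln (mu g)) by rewrite neg_xlnx_ge0// (prob_le1 _ mu_prob).
have Hnum : entropy mu \is a fin_num.
  by rewrite ge0_fin_numE// esum_ge0// => g _; rewrite lee_fin.
have h2 : 0 <= 2^-1 :> R by rewrite invr_ge0.
have h4 : 0 <= 4^-1 :> R by rewrite invr_ge0.
pose c2 : R := - (2^-1 * ln 2^-1); pose c4 : R := - (4^-1 * ln 4^-1).
have c20 : 0 <= c2 by rewrite neg_xlnx_ge0// invf_le1// ler1n.
have c40 : 0 <= c4 by rewrite neg_xlnx_ge0// invf_le1// ler1n.
have muT : \esum_(g in [set: 'M[R]_d]) (mu g)%:E = 1%E.
  rewrite -mu1 [RHS]esum_mkcond; apply: eq_esum => g _.
  by case: ifPn => // /negP gG; rewrite muG// => Gg; apply: gG; exact: mem_set.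
exists (2^-1 * fine (entropy mu) + c2 + (c4 + c4)) => k.
pose a := gamma ^+ k; pose b := invmx gamma ^+ k.
have dirac0 (c g : 'M[R]_d) : 0 <= dirac_mass c g by rewrite /dirac_mass ler0n.
have eta4 (c g : 'M[R]_d) : - (4^-1 * dirac_mass c g * ln (4^-1 * dirac_mass c g)) =
    dirac_mass c g * c4.
  rewrite neg_xlnx_mul ?invr_gt0// /dirac_mass.
  by case: (g == c); rewrite ?ln1 ?mul1r ?mul0r ?mulr0 ?oppr0 ?mulr0 ?add0r.
apply: (@le_trans _ _ (\esum_(g in [set: 'M[R]_d]) ((2^-1%:E * (- (mu g * ln (mu g)))%:E +
   c2%:E * (mu g)%:E) + ((dirac_mass a g * c4)%:E + (dirac_mass b g * c4)%:E)))%E).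
  apply: le_esum => g _; rewrite -!EFinM -!EFinD lee_fin /mu_k mulrDr -/a -/b.
  apply: le_trans (neg_xlnx_subadditive _ _) _; rewrite ?addr_ge0 ?mulr_ge0//.
  rewrite neg_xlnx_mul ?invr_gt0// [c2 * _]mulrC lerD2l.
  apply: le_trans (neg_xlnx_subadditive _ _) _; rewrite ?mulr_ge0//.
  by rewrite -!eta4.
rewrite esumD; last 2 first.
- by move=> g _; rewrite adde_ge0// -EFinM lee_fin mulr_ge0.
- by move=> g _; rewrite adde_ge0// lee_fin mulr_ge0.
rewrite esumD; last 2 first.
- by move=> g _; rewrite -EFinM lee_fin mulr_ge0.
- by move=> g _; rewrite -EFinM lee_fin mulr_ge0.
rewrite esumD; last 2 first.
- by move=> g _; rewrite lee_fin mulr_ge0.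
- by move=> g _; rewrite lee_fin mulr_ge0.
rewrite !ge0_esumZl//; [|by move=> g; rewrite lee_fin..].
rewrite muT mule1 !esum_dirac_mass// -/(entropy mu) -{1}(fineK Hnum).
by rewrite -EFinM -!EFinD.
Qed.

(** * The drift of mu_k *)

(* On reach n.+1, one step of a measure >= mu / 2 gains at least (q / 2) (q / 4)^n
   from the term n, which is twice the loss (q / 4)^n.+1 of the next term. *)
Definition potential (R : realType) (d : nat) (mu : 'M[R]_d -> R) (q : R)
    (A : set 'rV[R]_d) (M : nat) (v : 'rV[R]_d) : R :=
  \sum_(n < M.+1) (q / 4) ^+ n * `[< reach mu q A n v >]%:R.

Lemma potential_bounds (R : realType) (d : nat) (mu : 'M[R]_d -> R) (q : R)
    (A : set 'rV[R]_d) (M : nat) (v : 'rV[R]_d) :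
  0 <= q -> q <= 1 -> 0 <= potential mu q A M v <= M.+1%:R.
Proof.
move=> q0 q1; have c0 : 0 <= q / 4 by rewrite divr_ge0.
have c1 : q / 4 <= 1 by lra.
rewrite sumr_ge0 => [|n _]; last by rewrite mulr_ge0 ?exprn_ge0 ?ler0n.
rewrite -[X in _ <= X%:R]card_ord -sumr_const; apply: ler_sum => n _.
rewrite -[leRHS]mulr1 ler_pM ?exprn_ge0 ?ler0n ?exprn_ile1//.
by case: `[< _ >].
Qed.

Lemma potential_ge (R : realType) (d : nat) (mu : 'M[R]_d -> R) (q : R)
    (A : set 'rV[R]_d) (M n : nat) (v : 'rV[R]_d) :
  0 <= q -> q <= 1 -> (n <= M)%N -> reach mu q A n v ->
  (q / 4) ^+ M <= potential mu q A M v.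
Proof.
move=> q0 q1 nM vn; have c0 : 0 <= q / 4 by rewrite divr_ge0.
rewrite /potential (bigD1 (Ordinal (nM : n < M.+1)%N))//= asboolT// mulr1.
rewrite -[leLHS]addr0 lerD ?sumr_ge0// => [|m _]; last first.
  by rewrite mulr_ge0 ?exprn_ge0 ?ler0n.
by rewrite ler_wiXn2l//; lra.
Qed.

(** The mean of the term [n] after one step is at least twice the term [n.+1] at [v]. Summing over
    [n < M] loses only the term 0 at [v], the indicator of [A]. *)
Lemma potential_step (R : realType) (d : nat) (Gamma : set 'M[R]_d)
    (mu mu' : 'M[R]_d -> R) (q : R) (A : set 'rV[R]_d) (M : nat) (v : 'rV[R]_d) :
  0 < q -> (forall g, 0 <= mu g) -> (forall g, ~ Gamma g -> mu g = 0) ->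
  (forall g, 2^-1 * mu g <= mu' g) ->
  ((2 * (potential mu q A M v - `[< A v >]%:R))%:E <=
   \esum_(g in Gamma) (mu' g * potential mu q A M (v *m g))%:E)%E.
Proof.
move=> q0 mu0 muG mu'_ge; have c0 : 0 <= q / 4 by rewrite divr_ge0// ltW.
have mu'0 g : 0 <= mu' g by rewrite (le_trans _ (mu'_ge g))// mulr_ge0.
pose t n (u : 'rV[R]_d) := (q / 4) ^+ n * `[< reach mu q A n u >]%:R.
have t0 n u : 0 <= t n u by rewrite mulr_ge0 ?exprn_ge0 ?ler0n.
have step n : ((2 * t n.+1 v)%:E <= \esum_(g in Gamma) (mu' g * t n (v *m g))%:E)%E.
  have [[g qg vg]|no] := pselect (reach mu q A n.+1 v); last first.
    rewrite /t asboolF//= !mulr0; apply: esum_ge0 => g _.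
    by rewrite lee_fin mulr_ge0 ?t0.
  have Gg : Gamma g.
    by apply: contrapT => /muG mug; move: qg; rewrite mug leNgt q0.
  apply: (le_trans _ (ge0_esum_ge (c := g) _ Gg)); last first.
    by move=> x; rewrite lee_fin mulr_ge0 ?t0.
  rewrite lee_fin /t asboolT; last by exists g.
  rewrite asboolT// !mulr1 exprS.
  have : q / 2 <= mu' g by have := mu'_ge g; lra.
  have : 0 <= (q / 4) ^+ n by rewrite exprn_ge0.
  set x := _ ^+ n => x0 mug; have := ler_wpM2r x0 mug; lra.
have -> : 2 * (potential mu q A M v - `[< A v >]%:R) = \sum_(n < M) 2 * t n.+1 v.
  rewrite /potential big_ord_recl/= expr0 mul1r addrAC subrr add0r mulr_sumr.
  by [].
apply: (@le_trans _ _ (\sum_(n < M) \esum_(g in Gamma) (mu' g * t n (v *m g))%:E)%E).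
  by rewrite -sumEFin; apply: lee_sum => n _; exact: step.
rewrite -esum_sum; last by move=> g n _ _; rewrite lee_fin mulr_ge0 ?t0.
apply: le_esum => g _; rewrite sumEFin lee_fin -mulr_sumr ler_wpM2l//.
by rewrite /potential big_ord_recr/= lerDl t0.
Qed.

Lemma log_growth_bound (R : realType) (d : nat) (Q : 'M[R]_d) : Q \in unitmx ->
  exists2 c : R, 0 <= c & forall (v : 'rV[R]_d) (g : 'M[R]_d),
    \det g = 1 -> v != 0 ->
    `|ln (l1norm (v *m g *m Q)) - ln (l1norm (v *m Q))| <=
    c + d%:R * ln (Num.max 1 (enorm g)).
Proof.
move=> Qu; have [K K1 growth] := growth_bound Qu.
have K0 : 0 < K by rewrite (lt_le_trans ltr01).
exists (ln K); first exact: ln_ge0.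
move=> v g g1 v0; have [up down] := growth v g g1.
have gu : g \in unitmx by rewrite unitmxE g1 unitr1.
have pos (u : 'rV[R]_d) : u != 0 -> 0 < l1norm (u *m Q).
  move=> u0; apply: l1norm_gt0; apply: contra_neq u0 => uQ.
  by rewrite -(mulmxK Qu u) uQ mul0mx.
have vg0 : v *m g != 0.
  by apply: contra_neq v0 => vg; rewrite -(mulmxK gu v) vg mul0mx.
have E0 : 0 < Num.max 1 (enorm g) by rewrite lt_max ltr01.
have log_le (x y : R) : 0 < x -> 0 < y ->
    x <= K * Num.max 1 (enorm g) ^+ d * y ->
    ln x - ln y <= ln K + d%:R * ln (Num.max 1 (enorm g)).
  move=> x0 y0 xy; rewrite lerBlDr mulr_natl -lnXn// -!lnM ?posrE ?mulr_gt0 ?exprn_gt0//.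
  by rewrite ler_ln ?posrE ?mulr_gt0 ?exprn_gt0.
rewrite ler_norml; apply/andP; split; last exact: log_le (pos _ vg0) (pos _ v0) up.
by rewrite lerNl opprB; exact: log_le (pos _ v0) (pos _ vg0) down.
Qed.

(** The sum is a supremum over finite subsets, so it is monotone in the index set for terms of any
    sign, such as [ln (enorm g) * mu g]. *)
Lemma sub_esum (R : realType) (C : choiceType) (S S' : set C) (f : C -> \bar R) :
  S `<=` S' -> (\esum_(c in S) f c <= \esum_(c in S') f c)%E.
Proof.
move=> SS'; apply: ge_ereal_sup => _ [X [finX XS] <-].
by apply: ereal_sup_ubound; exists X => //; split=> // x /XS /SS'.
Qed.

Lemma log_moment_finite (R : realType) (d : nat) (Gamma : set 'M[R]_d)
    (mu : 'M[R]_d -> R) (c b : R) :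
  prob_on Gamma mu -> finite_first_moment mu -> 0 <= c -> 0 <= b ->
  (\esum_(g in Gamma) (mu g * (c + b * ln (Num.max 1 (enorm g))))%:E < +oo)%E.
Proof.
move=> [mu0 _ mu1] moment c0 b0.
have ln0 g : 0 <= ln (Num.max 1 (enorm g) : R) by rewrite ln_ge0// le_max lexx.
rewrite (eq_esum (b := fun g => (c%:E * (mu g)%:E +
    b%:E * (mu g * ln (Num.max 1 (enorm g)))%:E)%E)); last first.
  by move=> g _; rewrite -!EFinM -EFinD; congr (_%:E); ring.
rewrite esumD; last 2 first.
- by move=> g _; rewrite -EFinM lee_fin mulr_ge0.
- by move=> g _; rewrite -EFinM lee_fin !mulr_ge0.
rewrite !ge0_esumZl//; last first.
  by move=> g; rewrite lee_fin mulr_ge0.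
rewrite mu1 mule1 lte_add_pinfty ?ltry//.
suff fin : (\esum_(g in Gamma) (mu g * ln (Num.max 1 (enorm g)))%:E < +oo)%E.
  rewrite lte_mul_pinfty// ?lee_fin//.
apply: le_lt_trans moment.
(* Where [enorm g < 1] the truncated logarithm is [ln 1 = 0]. *)
rewrite (eq_esum (b := fun g => if g \in [set g | 1 <= enorm g]
   then (ln (enorm g) * mu g)%:E else 0%E)).
  by rewrite -esum_mkcondr; exact: sub_esum.
move=> g _; case: leP => g1; first by rewrite mem_set// mulrC.
by rewrite ln1 mulr0 memNset//= => /(lt_le_trans g1); rewrite ltxx.
Qed.

Lemma subgroup_expr (R : realType) (d : nat) (Gamma : set 'M[R]_d) (g : 'M[R]_d) k :
  subgroup_SL Gamma -> Gamma g -> Gamma (g ^+ k).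
Proof.
move=> [_ G1 GM _] Gg; elim: k => [|k IH]; first by rewrite expr0.
by rewrite exprS; exact: GM.
Qed.

(** The corrector is [phi = D * potential]. Its drift is at least [D * potential], minus [2 D] on
    good vectors; that loss is made up for by the growth under the powers of [gamma], of mass 1/4
    each. What remains is at least [D (q / 4) ^ M], linear in [k]. *)
Lemma mu_k_drift (R : realType) (d : nat) (Gamma : set 'M[R]_d)
    (mu : 'M[R]_d -> R) (gamma : 'M[R]_d) :
  (1 < d)%N -> subgroup_SL Gamma -> zariski_dense_SL Gamma ->
  prob_on Gamma mu -> finite_first_moment mu ->
  smallest (@mul_closed R d) (supp mu) = Gamma -> Gamma gamma -> R_regular gamma ->
  exists (Q : 'M[R]_d) (l : 'M[R]_d -> R) (kap C : R),
    [/\ Q \in unitmx, 0 < kap, forall g, 0 <= l g &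
      forall (v : 'rV[R]_d) g, \det g = 1 -> v != 0 ->
        `|ln (l1norm (v *m g *m Q)) - ln (l1norm (v *m Q))| <= l g] /\
    forall k,
      (\esum_(g in Gamma) (mu_k mu gamma k g * l g)%:E < +oo)%E /\
      exists (phi : 'rV[R]_d -> R) (D : R), (forall v, 0 <= phi v <= D) /\
        forall v, v != 0 ->
        ((k%:R * kap - C + D)%:E + \esum_(g in Gamma) (mu_k mu gamma k g * l g)%:E <=
         \esum_(g in Gamma) (mu_k mu gamma k g *
           (ln (l1norm (v *m g *m Q)) - ln (l1norm (v *m Q)) +
            (phi (v *m g) - phi v) + D + l g))%:E)%E.
Proof.
move=> d1 subG dense mu_prob moment gen Gg reg.
have [mu0 muG mu1] := mu_prob; have [GSL G1 GM GV] := subG.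
have [A [delta [kappa [Au kappa0 delta0 gA kappaP]]]] :=
  R_regular_eigenbasis (GSL _ Gg) reg.
have [e [q1 [M [e0 ed q10 reachP]]]] := reach_two_coords d1 dense mu0 gen Au.
pose q := Num.min q1 1.
have q0 : 0 < q by rewrite lt_min q10 ltr01.
have qle1 : q <= 1 by rewrite ge_min lexx orbT.
set Q := invmx A in gA reachP.
have Qu : Q \in unitmx by rewrite unitmx_inv.
have [c0 c00 lP] := log_growth_bound Qu.
pose l (g : 'M[R]_d) : R := c0 + d%:R * ln (Num.max 1 (enorm g)).
have l0 g : 0 <= l g by rewrite addr_ge0// mulr_ge0// ln_ge0// le_max lexx.
have gu : gamma \in unitmx by rewrite unitmxE (GSL _ Gg) unitr1.
pose L := fine (\esum_(g in Gamma) (mu g * l g)%:E)%E.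
have LE : \esum_(g in Gamma) (mu g * l g)%:E = L%:E.
  rewrite fineK// ge0_fin_numE; first exact: log_moment_finite mu_prob _ _ _.
  by apply: esum_ge0 => g _; rewrite lee_fin mulr_ge0.
(* In the second constant, [L / 2] is the possible loss on the half [mu], where the increment is
   only known to be at least [- l], and [- ln e / 2] is a quarter of the error term of
   [diagonal_growth]. *)
exists Q, l, (kappa / 8 * (q / 4) ^+ M), (L / 2 - ln e / 2); split.
  by split=> //; rewrite mulr_gt0 ?exprn_gt0 ?divr_gt0.
move=> k; pose a := gamma ^+ k; pose b := invmx gamma ^+ k.
have Ga : Gamma a by exact: subgroup_expr.
have Gb : Gamma b by apply: subgroup_expr => //; exact: GV.
have int (f : 'M[R]_d -> R) (f0 : forall g, 0 <= f g) := esum_mu_k mu0 f0 Ga Gb.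
have intl : \esum_(g in Gamma) (mu_k mu gamma k g * l g)%:E =
    (2^-1 * L + 4^-1 * (l a + l b))%:E.
  by rewrite int// LE -EFinM -EFinD.
split; first by rewrite intl ltry.
(* With this choice the growth [k kappa] on good vectors is [8 D]; weighted by 1/4 it cancels
   exactly the loss [2 D]. *)
pose D := k%:R * (kappa / 8).
have D0 : 0 <= D by rewrite mulr_ge0// divr_ge0// ltW.
pose good := two_coords Q e.
pose phi v := D * potential mu q good M v.
have phi_bounds v : 0 <= phi v <= D * M.+1%:R.
  have /andP[p0 p1] := potential_bounds mu good M v (ltW q0) qle1.
  by rewrite mulr_ge0// ler_wpM2l.
exists phi, (D * M.+1%:R); split=> // v v0.
have vQ0 : v *m Q != 0.
  by apply: contra_neq v0 => vQ; rewrite -(mulmxK Qu v) vQ mul0mx.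
pose F g := ln (l1norm (v *m g *m Q)) - ln (l1norm (v *m Q)).
have lF g : Gamma g -> 0 <= F g + l g.
  by move=> /GSL g1; have := lP v g g1 v0; rewrite ler_norml /F /l => /andP[]; lra.
have mk0 g : 0 <= mu_k mu gamma k g.
  by rewrite addr_ge0 ?mulr_ge0 ?addr_ge0 ?ler0n.
have growth : 8 * D * `[< good v >]%:R + 2 * ln e <= F a + F b.
  have dg i j := diagonal_growth k gu delta0 gA vQ0 e0 (i := i) (j := j).
  have [[i [j [ij xi xj]]]|bad] := pselect (good v).
    rewrite asboolT; last by exists i, j.
    have kk : 8 * D = k%:R * kappa by rewrite /D; field.
    rewrite mulr1 kk; have := kappaP i j ij.
    have k0 : 0 <= k%:R :> R by [].
    have [s|s] := leP 0 (ln `|delta i| - ln `|delta j|).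
      rewrite ger0_norm// => /(ler_wpM2l k0).
      by have := dg i j xi xj; rewrite /F -/a -/b; lra.
    rewrite ltr0_norm// => /(ler_wpM2l k0).
    by have := dg j i xj xi; rewrite /F -/a -/b; lra.
  rewrite asboolF// mulr0 add0r; have [i xi] := big_coord vQ0 ed.
  by have := dg i i xi xi; rewrite subrr mulr0 /F -/a -/b; lra.
have pot_ge : (q / 4) ^+ M <= potential mu q good M v.
  have [n nM vn] := reachP v v0; apply: (potential_ge (ltW q0) qle1 nM).
  by apply: reach_mono vn => //; rewrite ge_min lexx.
pose f1 g := Num.max 0 (F g + l g).
have f10 g : 0 <= f1 g by rewrite le_max lexx.
have phi3 : 0 <= D * M.+1%:R - phi v by have /andP[] := phi_bounds v; rewrite subr_ge0.
have mphi0 g : 0 <= mu_k mu gamma k g * phi (v *m g).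
  by rewrite mulr_ge0//; have /andP[] := phi_bounds (v *m g).
(* The sum splits into three nonnegative ones: the logarithmic growth, the new value of [phi], and a
   constant. *)
have split_f : \esum_(g in Gamma) (mu_k mu gamma k g *
    (F g + (phi (v *m g) - phi v) + D * M.+1%:R + l g))%:E =
    (\esum_(g in Gamma) (mu_k mu gamma k g * f1 g)%:E +
     (\esum_(g in Gamma) (mu_k mu gamma k g * phi (v *m g))%:E +
      \esum_(g in Gamma) (mu_k mu gamma k g * (D * M.+1%:R - phi v))%:E))%E.
  rewrite -esumD; last 2 first.
  - by move=> g _; rewrite lee_fin.
  - by move=> g _; rewrite lee_fin mulr_ge0 ?f10 ?phi3.
  rewrite -esumD; last 2 first.
  - by move=> g _; rewrite lee_fin mulr_ge0 ?f10 ?phi3.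
  - by move=> g _; rewrite -EFinD lee_fin addr_ge0// mulr_ge0.
  apply: eq_esum => g G_g; rewrite -!EFinD; congr (_%:E).
  by rewrite /f1 max_r ?lF//; ring.
have part1 : ((4^-1 * (F a + l a + (F b + l b)))%:E <=
    \esum_(g in Gamma) (mu_k mu gamma k g * f1 g)%:E)%E.
  rewrite int// -[leLHS]add0e leeD//.
    by rewrite mule_ge0// ?lee_fin// esum_ge0// => g _; rewrite lee_fin mulr_ge0.
  by rewrite lee_fin ler_wpM2l ?invr_ge0// lerD// /f1 le_max lexx orbT.
have part2 : ((D * (2 * (potential mu q good M v - `[< good v >]%:R)))%:E <=
    \esum_(g in Gamma) (mu_k mu gamma k g * phi (v *m g))%:E)%E.
  rewrite (eq_esum (b := fun g => (D%:E *
      (mu_k mu gamma k g * potential mu q good M (v *m g))%:E)%E)); last first.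
    by move=> g _; rewrite -EFinM; congr (_%:E); rewrite /phi; ring.
  rewrite ge0_esumZl//.
    rewrite EFinM lee_wpmul2l ?lee_fin//.
    apply: (potential_step _ _ _ q0 mu0 muG) => g.
    by rewrite /mu_k lerDl mulr_ge0 ?addr_ge0 ?ler0n.
  move=> g; rewrite lee_fin mulr_ge0//.
  by have /andP[] := potential_bounds mu good M (v *m g) (ltW q0) qle1.
have part3 : \esum_(g in Gamma) (mu_k mu gamma k g * (D * M.+1%:R - phi v))%:E =
    (D * M.+1%:R - phi v)%:E.
  rewrite (int (fun=> _))// (eq_esum (b := fun g =>
    ((D * M.+1%:R - phi v)%:E * (mu g)%:E)%E)).
    by rewrite ge0_esumZl// mu1 mule1 -EFinM -EFinD; congr (_%:E); field.
  by move=> g _; rewrite -EFinM mulrC.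
have := split_f; rewrite {1}/F => ->; rewrite part3 intl.
apply: le_trans (leeD part1 (leeD part2 (lexx _))).
rewrite -!EFinD lee_fin.
have := ler_wpM2l D0 pot_ge.
have -> : k%:R * (kappa / 8 * (q / 4) ^+ M) = D * (q / 4) ^+ M by rewrite /D mulrA.
by rewrite /phi; lra.
Qed.

(** * The top exponent *)

(** The walk starts at the vector with all coordinates 1. Its norm is at most a constant times the
    top singular value of the product, so the exponent of the walk does not exceed [lam 0 i0], and
    [drift_le_exponent] applies. *)
Lemma top_exponent_ge (R : realType) (d : nat) (Gamma : set 'M[R]_d)
    (mu : 'M[R]_d -> R) (Q : 'M[R]_d) (l : 'M[R]_d -> R) (phi : 'rV[R]_d -> R)
    (D a : R) (lam : 'rV[R]_d) (i0 : 'I_d) :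
  nat_of_ord i0 = 0%N -> subgroup_SL Gamma -> countable Gamma -> Q \in unitmx ->
  (forall g, 0 <= l g) ->
  (forall (v : 'rV[R]_d) g, \det g = 1 -> v != 0 ->
     `|ln (l1norm (v *m g *m Q)) - ln (l1norm (v *m Q))| <= l g) ->
  (\esum_(g in Gamma) (mu g * l g)%:E < +oo)%E ->
  (forall v, 0 <= phi v <= D) ->
  (forall v, v != 0 ->
     ((a + D)%:E + \esum_(g in Gamma) (mu g * l g)%:E <=
      \esum_(g in Gamma) (mu g *
        (ln (l1norm (v *m g *m Q)) - ln (l1norm (v *m Q)) +
         (phi (v *m g) - phi v) + D + l g))%:E)%E) ->
  lyapunov_vector Gamma mu lam -> a <= lam 0 i0.
Proof.
move=> i00 [GSL G1 GM _] cG Qu l0 lP lfin phiD drift [disp [T [P [h [hiid ae_lam]]]]].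
have dpos : (0 < d)%N by rewrite (leq_ltn_trans _ (ltn_ord i0)).
pose v0 : 'rV[R]_d := const_mx 1.
have v00 : v0 != 0.
  by apply/eqP => /matrixP/(_ 0 i0); rewrite !mxE; apply/eqP; rewrite oner_eq0.
pose walk s := v0 *m \prod_(g <- s) g.
have walk_rcons s g : walk (rcons s g) = walk s *m g.
  by rewrite /walk -cats1 big_cat big_seq1 -mulmxE mulmxA.
have prodG n s : words Gamma n s -> Gamma (\prod_(g <- s) g).
  move=> [_ sG]; rewrite big_seq; apply: (big_ind Gamma) => [|g g' Gg Gg'|g /sG//].
    exact: G1.
  exact: GM.
have mul_neq0 (v : 'rV[R]_d) g : g \in unitmx -> v != 0 -> v *m g != 0.
  by move=> gu; apply: contra_neq => vg; rewrite -(mulmxK gu v) vg mul0mx.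
have walk0 n s : words Gamma n s -> walk s != 0.
  by move=> /prodG/GSL s1; rewrite mul_neq0// unitmxE s1 unitr1.
pose Z s := ln (l1norm (walk s *m Q)).
apply: (drift_le_exponent (Z := Z) (phi := fun s => phi (walk s)) (D := D)
  cG hiid l0 lfin) => //.
- move=> n s g sW Gg; rewrite /Z walk_rcons; apply: lP; first exact: GSL.
  exact: walk0 sW.
- move=> n s sW; rewrite (le_trans (drift _ (walk0 _ _ sW)))//.
  by under [leRHS]eq_esum => g _ do rewrite /Z walk_rcons.
apply: filterS ae_lam => w [s [s_sing s_lim]].
(* The factor [d * d] comes from [l1norm_le], the other [d] from [enorm_le_singular]. *)
pose K := l1norm v0 * ((d * d)%:R * d%:R) * l1norm Q.
have K0 : 0 < K.
  rewrite !mulr_gt0 ?l1norm_gt0 ?ltr0n ?muln_gt0 ?dpos//.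
  by have := mul_neq0 v0 Q Qu v00; apply: contra_neq => ->; rewrite mulmx0.
exists (fun n => n%:R^-1 * ln (s n 0 i0) + n%:R^-1 * (ln K - Z [::])).
  rewrite -[lam 0 i0]addr0; apply: cvgD; first exact: s_lim.
  rewrite -[X in _ --> X](mul0r (ln K - Z [::])).
  apply: cvgMr_tmp; rewrite -(cvg_shiftS (fun n => n%:R^-1 : R^o)).
  exact: cvg_harmonic.
(* At time 0 both sides vanish; the division by [n] needs a positive time. *)
move=> [|n]; first by rewrite mul0r subrr.
rewrite -mulrDr mulrA divff ?pnatr_eq0// mul1r addrA lerB//.
have [hG _ _ _] := hiid; have hW := history_words n.+1 w hG.
have prodE : \prod_(m < n.+1) h m w = \prod_(g <- history h n.+1 w) g.
  by rewrite /history big_map -(big_mkord xpredT (fun i => h i w)) /index_iota subn0.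
have Zpos : 0 < l1norm (walk (history h n.+1 w) *m Q).
  by rewrite l1norm_gt0// mul_neq0// (walk0 _ _ hW).
have up : l1norm (walk (history h n.+1 w) *m Q) <= K * s n.+1 0 i0.
  apply: le_trans (l1norm_mul _ _) _; rewrite /K mulrAC ler_wpM2r ?l1norm_ge0//.
  apply: le_trans (l1norm_mul _ _) _; rewrite -!mulrA ler_wpM2l ?l1norm_ge0//.
  rewrite -prodE; apply: le_trans (l1norm_le (normr_le_enorm _)) _.
  by rewrite ler_wpM2l// (enorm_le_singular i00 (s_sing _)).
have s0 : 0 < s n.+1 0 i0 by rewrite -(pmulr_rgt0 _ K0) (lt_le_trans Zpos).
by rewrite -lnM ?posrE// mulrC ler_ln ?posrE// (lt_le_trans Zpos).
Qed.

Theorem theorem9p4 (R : realType) (d : nat) (hd : (1 < d)%N)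
    (Gamma : set 'M[R]_d)
    (hGamma : subgroup_SL Gamma)
    (hcount : countable Gamma)
    (hdense : zariski_dense_SL Gamma)
    (mu : 'M[R]_d -> R)
    (hmu : prob_on Gamma mu)
    (hentropy : (entropy mu < +oo)%E)
    (hmoment : finite_first_moment mu)
    (hgen : smallest (@mul_closed R d) (supp mu) = Gamma)
    (gamma : 'M[R]_d)
    (hgamma : Gamma gamma)
    (hreg : R_regular gamma) :
  (exists C : R, forall k : nat, (1 <= k)%N ->
     (entropy (mu_k mu gamma k) <= C%:E)%E) /\
  (forall lam : nat -> 'rV[R]_d,
     (forall k : nat, (1 <= k)%N ->
        lyapunov_vector Gamma (mu_k mu gamma k) (lam k)) ->
     (fun k => enorm (lam k)) @ \oo --> +oo /\
     (fun k => lam k 0 (Ordinal (ltnW hd))) @ \oo --> +oo).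
Proof.
split.
  have [C HC] := entropy_mu_k_bounded gamma hmu hentropy.
  by exists C => k _.
have [Q [l [kap [C [[Qu kap0 l0 lP] drift]]]]] :=
  mu_k_drift hd hGamma hdense hmu hmoment hgen hgamma hreg.
move=> lam hlam; set i0 := Ordinal (ltnW hd).
(* [kap] and [C] do not depend on [k], whereas [phi] and its bound [D] may. *)
have lam_ge k : (1 <= k)%N -> k%:R * kap - C <= lam k 0 i0.
  move=> k1; have [lfin [phi [D [phiD dr]]]] := drift k.
  exact: (top_exponent_ge _ hGamma hcount Qu l0 lP lfin phiD dr (hlam k k1)).
have lam_cvg : (fun k => lam k 0 i0) @ \oo --> +oo.
  apply/cvgryPge => B; pose N := Num.bound ((B + C) / kap).
  exists N.+1 => // k /= Nk; apply: le_trans (lam_ge k _).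
    rewrite lerBrDr -ler_pdivrMr//.
    have [ge0|lt0] := leP 0 ((B + C) / kap); last first.
      by rewrite (le_trans (ltW lt0)).
    by rewrite (le_trans (ltW (archi_boundP ge0)))// ler_nat ltnW.
  by rewrite (leq_trans _ Nk).
(* The Euclidean length dominates the top coordinate, so it diverges as well. *)
split=> //; apply/cvgryPge => B.
have [N _ HN] := (cvgryPge _).1 lam_cvg B.
exists N => // k Nk; apply: le_trans (HN k Nk) _.
by rewrite (le_trans (ler_norm _))// normr_le_enorm.
Qed.
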